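(* Let $\mathbb{S}$ be the 2-sphere, let $n\geqslant 2$, and let $\big(\mathbb{S},\mathbb{S},n,d,(d_{ij})\big)$ be a branch datum. Suppose that $d$ and all $d_{ij}$ for $i=1,2$ are multiples of some integer $k$ with $1<k<d$. If the branch datum is realizable, then $d_{ij}\leqslant d/k$ for $i=3,\ldots,n$ and for all $j$.
   Context: A branched covering is a map $f:\widetilde\Sigma\to\Sigma$ between closed connected surfaces locally modelled on $\mathbb{C}\ni z\mapsto z^k\in\mathbb{C}$, $k\geqslant 1$; the integer $k$ is the local degree at the point of $\widetilde\Sigma$ corresponding to $0$, and if $k>1$ the image point is a branching point. The degree of $f$ is the degree of the genuine covering obtained by removing the branching points and their preimages. A branch datum $\big(\widetilde\Sigma,\Sigma,n,d,(d_{ij})\big)$ consists of closed connected surfaces $\widetilde\Sigma,\Sigma$, integers $n\geqslant 0$, $d\geqslant 2$, and for each $i=1,\ldots,n$ a partition $(d_{ij})_{j=1,\ldots,m_i}$ of $d$ (positive integers with sum $d$). The datum is realizable if there exist a branched covering $f:\widetilde\Sigma\to\Sigma$ of degree $d$ and $n$ distinct points $x_1,\ldots,x_n\in\Sigma$, including all branching points of $f$, such that for each $i$ the local degrees of $f$ at the points of $f^{-1}(x_i)$ form the partition $(d_{ij})_{j=1,\ldots,m_i}$. *)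

(* Defs.v *)
From HB Require Import structures.
From mathcomp Require Import all_boot all_order all_algebra.
From mathcomp Require Import complex ring.
From mathcomp Require Import all_classical all_reals all_analysis.

Set Implicit Arguments.
Unset Strict Implicit.
Unset Printing Implicit Defensive.

Import Order.TTheory GRing.Theory Num.Theory.
Import numFieldNormedType.Exports.

Local Open Scope classical_set_scope.
Local Open Scope ring_scope.

(* [phi] restricts to a homeomorphism from the subspace [A] of [X] onto the
   subspace [B] of [Y]; its values outside [A] are irrelevant. *)
Definition homeo_on (X Y : topologicalType) (A : set X) (B : set Y)
    (phi : X -> Y) : Prop :=
  exists psi : Y -> X,
    [/\ {within A, continuous phi}, {within B, continuous psi},
        (forall x, A x -> B (phi x) /\ psi (phi x) = x) &
        (forall y, B y -> A (psi y) /\ phi (psi y) = y)].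

(* [R[i]^o] is the field of complex numbers with the topology of its norm. *)
Definition chart (R : realType) (X : topologicalType) (U : set X)
    (phi : X -> R[i]^o) : Prop :=
  open U /\ homeo_on U [set: R[i]^o] phi.

(* Second countability is automatic, by compactness. *)
Definition closed_connected_surface (R : realType) (X : topologicalType) :
    Prop :=
  [/\ compact [set: X], connected [set: X], hausdorff_space X &
      forall p : X, exists (U : set X) (phi : X -> R[i]^o),
        U p /\ chart U phi].

(* In suitable charts centred at [p] and [f p], [f] reads [z |-> z ^+ k]. *)
Definition local_degree (R : realType) (X Y : topologicalType) (f : X -> Y)
    (p : X) (k : nat) : Prop :=
  (1 <= k)%N /\
  exists (U : set X) (V : set Y) (phi : X -> R[i]^o) (psi : Y -> R[i]^o),
    [/\ chart U phi, chart V psi,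
        U p /\ phi p = 0,
        V (f p) /\ psi (f p) = 0 &
        forall x, U x -> V (f x) /\ psi (f x) = phi x ^+ k].

Definition branched_covering (R : realType) (X Y : topologicalType)
    (f : X -> Y) : Prop :=
  continuous f /\ forall p, exists k, local_degree R f p k.

Definition branching_point (R : realType) (X Y : topologicalType)
    (f : X -> Y) (y : Y) : Prop :=
  exists (p : X) (k : nat), [/\ f p = y, (1 < k)%N & local_degree R f p k].

(* Away from the branching points and their preimages a branched covering of
   closed connected surfaces is a genuine covering, whose degree is the
   cardinality of each of its fibres. *)
Definition degree (R : realType) (X Y : topologicalType) (f : X -> Y)
    (d : nat) : Prop :=
  forall y, ~ branching_point R f y -> (f @^-1` [set y] #= `I_d)%card.

(* The indices [1, ..., n] and [1, ..., m_i] of the entries [d_ij] are shifted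
   to [0, ..., n - 1] and [0, ..., m_i - 1]. *)
Definition branch_datum (R : realType) (X Y : topologicalType) (n d : nat)
    (m : 'I_n -> nat) (dd : forall i : 'I_n, 'I_(m i) -> nat) : Prop :=
  [/\ closed_connected_surface R X, closed_connected_surface R Y,
      (2 <= d)%N &
      forall i, (forall j, (0 < dd i j)%N) /\ (\sum_j dd i j = d)%N].

(* The injective enumeration [e] of the fibre over [x i] matches the local
   degrees with the entries of the [i]-th partition. *)
Definition realizable (R : realType) (X Y : topologicalType) (n d : nat)
    (m : 'I_n -> nat) (dd : forall i : 'I_n, 'I_(m i) -> nat) : Prop :=
  exists (f : X -> Y) (x : 'I_n -> Y),
    [/\ branched_covering R f, degree R f d, injective x,
        branching_point R f `<=` range x &
        forall i, exists e : 'I_(m i) -> X,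
          [/\ injective e, range e = f @^-1` [set x i] &
              forall j, local_degree R f (e j) (dd i j)]].

(* The unit sphere of [R^3], with the subspace topology. *)
Definition sphere (R : realType) : topologicalType :=
  set_type [set v : 'rV[R]_3 | \sum_i v ord0 i ^+ 2 = 1].

Section complex_topology.
Context {R : realType}.
Local Notation C := (R[i]^o).

Lemma real_complex_continuous : continuous (fun x : R => x%:C%C : C).
Proof.
move=> x; apply/cvgrPdist_lt => e e0.
have eE : e = (complex.Re e)%:C%C by rewrite RRe_real// gtr0_real.
have r0 : 0 < complex.Re e by move: e0; rewrite {1}eE ltcR.
have H : \forall t \near nbhs x, `|x - t| < complex.Re e by exact: (@cvgr_dist_lt _ R _ _ (nbhs_filter x) id x (@cvg_id _ (nbhs x)) _ r0).
apply: filterS H => y yx.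
by rewrite -rmorphB /= normc_def /= expr0n addr0 sqrtr_sqr {1}eE ltcR.
Qed.

Lemma Re_continuous : continuous (fun z : C => complex.Re z : R).
Proof.
move=> z; apply/(@cvgrPdist_lt _ R _ _ (nbhs_filter z)) => e e0.
have e0' : 0 < e%:C%C :> R[i] by rewrite ltcR.
have H : \forall t \near nbhs z, `|z - t| < e%:C%C by exact: (@cvgr_dist_lt _ C _ _ (nbhs_filter z) id z (@cvg_id _ (nbhs z)) _ e0').
apply: filterS H => y yz.
rewrite -ltcR; apply: (@le_lt_trans _ _ (`|z - y|)) => //.
have -> : complex.Re (z : R[i]) - complex.Re (y : R[i]) =
    complex.Re ((z : R[i]) - y)%R by case: (z) (y) => [a b] [c d].
exact: normc_ge_Re.
Qed.

Lemma Im_continuous : continuous (fun z : C => complex.Im z : R).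
Proof.
have -> : (fun z : C => complex.Im z : R) =
    (fun z : C => complex.Re z : R) \o (fun z : C => z * (- 'i%C : C)).
  by apply/funext => -[a b] /=; ring.
move=> z; apply: continuous_comp; last exact: Re_continuous.
apply: (@continuousM R[i] C (fun z => z) (fun=> - 'i%C) z); [exact: (@cvg_id _ (nbhs z))|exact: (@cvg_cst _ _ _ (nbhs z))].
Qed.

Lemma Complex_cvg (T : topologicalType) (a b : T -> R) (x : T) :
  {for x, continuous a} -> {for x, continuous b} ->
  {for x, continuous (fun t => Complex (a t) (b t) : C)}.
Proof.
move=> ca cb.
have -> : (fun t => Complex (a t) (b t) : C) =
   (fun t => ((a t)%:C%C : C) + ('i%C : C) * ((b t)%:C%C : C)).
  by apply/funext => t; rewrite -[LHS]/(Complex (a t) (b t) : R[i]) [LHS]complexE.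
have hb : {for x, continuous (fun t => ('i%C : C) * ((b t)%:C%C : C))}.
  apply: (@continuousM R[i] T (fun=> _) _ x (cvg_cst _)).
  by apply: (continuous_comp cb); exact: real_complex_continuous.
apply: (@continuousD R[i] C T _ _ x _ hb).
by apply: (continuous_comp ca); exact: real_complex_continuous.
Qed.

Lemma connected_C : connected [set: C].
Proof.
pose seg (z : C) := (fun t : R => (t%:C%C : C) * z) @` `[0, 1].
have -> : [set: C] = \bigcup_(z in [set: C]) seg z.
  apply/seteqP; split => // z _; exists z => //.
  exists 1; first by rewrite /= in_itv/= lexx ler01.
  by rewrite -[(1%:C)%C]/(1 : R[i]) mul1r.
apply: bigcup_connected.
  by exists 0 => z _; exists 0; [rewrite /= in_itv/= lexx ler01|rewrite -[(0%:C)%C]/(0 : R[i]) mul0r].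
move=> z _; apply: connected_continuous_connected; first exact: segment_connected.
apply: continuous_subspaceT => t; apply: (@continuousM R[i] R _ (fun=> z) t _ (cvg_cst _)).
exact: real_complex_continuous.
Qed.
End complex_topology.

Section sphere_topology.
Context {R : realType}.
Local Notation C := (R[i]^o).
Local Notation S := (sphere R).

Definition coord3 (i : 'I_3) (x : S) : R := (\val x : 'rV[R]_3) ord0 i.

Lemma coord3E (x : S) : coord3 (inord 0) x ^+ 2 + coord3 (inord 1) x ^+ 2 + coord3 (inord 2) x ^+ 2 = 1.
Proof.
have /set_mem /= := valP x; rewrite !big_ord_recl big_ord0 addr0 addrA => <-.
rewrite /coord3; congr (_ + _ + _); congr (_ ^+ 2);
 by congr (fun_of_matrix _ _ _); apply/val_inj; rewrite /= inordK.
Qed.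

Lemma coord3_inj (x y : S) : coord3 (inord 0) x = coord3 (inord 0) y ->
  coord3 (inord 1) x = coord3 (inord 1) y -> coord3 (inord 2) x = coord3 (inord 2) y -> x = y.
Proof.
move=> h0 h1 h2; apply/val_inj/rowP => i.
have : i = inord i by rewrite inord_val.
by case: i => -[|[|[|//]]] ? ->.
Qed.

Lemma val_continuous : continuous (\val : S -> 'rV[R]_3).
Proof. exact: initial_continuous. Qed.

Lemma coord3_continuous i : continuous (coord3 i).
Proof.
move=> x; apply: (@continuous_comp _ _ _ (\val : S -> 'rV[R]_3)
  (fun v : 'rV[R]_3 => v ord0 i)); first exact: val_continuous.
exact: coord_continuous.
Qed.

Lemma sphere_continuous (T : topologicalType) (g : T -> S) :
  (forall i, continuous (fun t => coord3 i (g t))) -> continuous g.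
Proof.
move=> h t U [_ [[W oW <-] Wgt WU]].
have /(_ _ Wgt) [P nP PW] : W `<=` W° by rewrite -open_subsetE.
suff : \forall s \near t, forall i, P ord0 i (coord3 i (g s)).
  move=> H; near=> s; apply: WU => /=; apply: PW => i j; rewrite (ord1 i).
  by move: j; near: s.
by apply: filter_forall => i; apply: (h i t); exact: nP.
Unshelve. all: by end_near. Qed.


Lemma sphere_hausdorff : hausdorff_space S.
Proof.
move=> x y cl; apply/val_inj; apply: (@norm_hausdorff _ 'rV[R]_3) => A B nA nB.
have [t [At Bt]] := cl _ _ (@val_continuous x _ nA) (@val_continuous y _ nB).
by exists (\val t).
Qed.

Definition mkrow (a b c : R) : 'rV[R]_3 := \row_i [:: a; b; c]`_i.

Lemma mkrowP (a b c : R) : a ^+ 2 + b ^+ 2 + c ^+ 2 = 1 ->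
  mkrow a b c \in [set v : 'rV[R]_3 | \sum_i v ord0 i ^+ 2 = 1].
Proof. by move=> h; rewrite inE /= !big_ord_recl big_ord0 addr0 addrA !mxE. Qed.

Lemma den_gt0 (z : C) : 0 < complex.Re z ^+ 2 + complex.Im z ^+ 2 + 1 :> R.
Proof. by rewrite ltr_wpDl// addr_ge0// sqr_ge0. Qed.

Lemma stereo_invP (s : R) (z : C) : s ^+ 2 = 1 ->
  let a : R := complex.Re z in let b : R := complex.Im z in
  let D := a ^+ 2 + b ^+ 2 + 1 in
  (2 * a / D) ^+ 2 + (2 * b / D) ^+ 2 + (s * (D - 2) / D) ^+ 2 = 1.
Proof.
move=> s1 a b D; have D0 : D != 0 by rewrite gt_eqF// den_gt0.
have ab : a ^+ 2 + b ^+ 2 = D - 1 by rewrite /D; ring.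
clearbody D a b; transitivity ((4 * (a ^+ 2 + b ^+ 2) + s ^+ 2 * (D - 2) ^+ 2) / D ^+ 2).
  by field.
by rewrite s1 ab; field.
Qed.

Definition stereo_inv (s : R) (s1 : s ^+ 2 = 1) (z : C) : S :=
  exist (fun x => x \in [set v : 'rV[R]_3 | \sum_i v ord0 i ^+ 2 = 1]) _ (mkrowP (stereo_invP z s1)).

Lemma stereo_inv0 s s1 z : coord3 (inord 0) (@stereo_inv s s1 z) =
  2 * complex.Re z / (complex.Re z ^+ 2 + complex.Im z ^+ 2 + 1).
Proof. by rewrite /coord3 /= mxE inordK. Qed.
Lemma stereo_inv1 s s1 z : coord3 (inord 1) (@stereo_inv s s1 z) =
  2 * complex.Im z / (complex.Re z ^+ 2 + complex.Im z ^+ 2 + 1).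
Proof. by rewrite /coord3 /= mxE inordK. Qed.
Lemma stereo_inv2 s s1 z : coord3 (inord 2) (@stereo_inv s s1 z) =
  s * (complex.Re z ^+ 2 + complex.Im z ^+ 2 + 1 - 2) / (complex.Re z ^+ 2 + complex.Im z ^+ 2 + 1).
Proof. by rewrite /coord3 /= mxE inordK. Qed.

(* Stereographic projection from [(0, 0, s)], for [s = 1] or [s = -1]. *)
Definition stereo (s : R) (x : S) : C :=
  Complex (coord3 (inord 0) x / (1 - s * coord3 (inord 2) x))
          (coord3 (inord 1) x / (1 - s * coord3 (inord 2) x)).

Definition stereo_dom (s : R) : set S := [set x | coord3 (inord 2) x != s].

Lemma stereo_dom_neq0 s x : s ^+ 2 = 1 -> stereo_dom s x -> 1 - s * coord3 (inord 2) x != 0.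
Proof.
move=> s1; apply: contra_neq => h.
have /eqP : s * (s - coord3 (inord 2) x) = 0 by rewrite mulrBr -expr2 s1.
rewrite mulf_eq0 => /orP[/eqP s0|]; last by rewrite subr_eq0 => /eqP.
by move: s1; rewrite s0 expr0n /= => /esym/eqP; rewrite oner_eq0.
Qed.

Lemma stereo_inv_dom s s1 z : stereo_dom s (@stereo_inv s s1 z).
Proof.
rewrite /stereo_dom /= stereo_inv2; set D : R := _ + 1.
have D0 : D != 0 by rewrite gt_eqF// den_gt0.
apply/eqP => h; have : s * (D - 2) = s * D by rewrite -[in RHS]h; field.
move=> /(congr1 ( *%R s)); rewrite !mulrA -expr2 s1 !mul1r => /eqP.
by rewrite subr_eq -subr_eq0 opprD addrA subrr add0r oppr_eq0 pnatr_eq0.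
Qed.

Lemma stereo_invK s s1 : cancel (@stereo_inv s s1) (stereo s).
Proof.
move=> z; rewrite /stereo stereo_inv0 stereo_inv1 stereo_inv2.
have := den_gt0 z; case: z => a b /=; set D : R := _ + 1 => D0.
have {}D0 : D != 0 by rewrite gt_eqF.
clearbody D.
have -> : 1 - s * (s * (D - 2) / D) = 2 / D.
  by rewrite !mulrA -expr2 s1; field.
have h (c : R) : 2 * c / D / (2 / D) = c by field.
by congr Complex; exact: h.
Qed.

Lemma stereoK s s1 : {in stereo_dom s, cancel (stereo s) (@stereo_inv s s1)}.
Proof.
move=> x /set_mem dx; have E := coord3E x; have n0 := stereo_dom_neq0 s1 dx.
have sum : complex.Re (stereo s x) ^+ 2 + complex.Im (stereo s x) ^+ 2 + 1 =
   2 / (1 - s * coord3 (inord 2) x).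
  rewrite /=; set u := coord3 (inord 0) x in E *; set v := coord3 (inord 1) x in E *.
  set w := coord3 (inord 2) x in E n0 *.
  rewrite !exprMn -mulrDl.
  have -> : u ^+ 2 + v ^+ 2 = (1 - s * w) * (1 + s * w).
    have -> : (1 - s * w) * (1 + s * w) = 1 - s ^+ 2 * w ^+ 2 by ring.
    by rewrite s1 mul1r -[X in _ = X - _]E; ring.
  by field.
have h (q c : R) : q != 0 -> 2 * (c / q) / (2 / q) = c by move=> q0; field.
apply: coord3_inj; rewrite ?(stereo_inv0, stereo_inv1, stereo_inv2) sum; [exact: h|exact: h|].
have h2 (q : R) : q != 0 -> s * (2 / q - 2) / (2 / q) = s * (1 - q).
  by move=> q0; field.
by rewrite h2// opprB addrC subrK mulrA -expr2 s1 mul1r.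
Qed.

Lemma stereo_inv_continuous s s1 : continuous (@stereo_inv s s1).
Proof.
have cRe := @Re_continuous R. have cIm := @Im_continuous R.
have cD : continuous (fun z : C => (complex.Re z ^+ 2 + complex.Im z ^+ 2 + 1 : R)).
  move=> z; apply: (@continuousD R R C); last exact: cst_continuous.
  by apply: (@continuousD R R C); apply: (@continuousM R C); [exact: cRe|exact: cRe|exact: cIm|exact: cIm].
have cV : continuous (fun z : C => (complex.Re z ^+ 2 + complex.Im z ^+ 2 + 1 : R)^-1).
  move=> z; apply: (@continuousV R C) => //; last exact: cD.
  by rewrite gt_eqF// den_gt0.
apply: sphere_continuous => i.
have -> : i = inord i by rewrite inord_val.
case: i => -[|[|[|//]]] ? z /=.
- under [X in continuous_at _ X]eq_fun do rewrite stereo_inv0.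
  apply: (@continuousM R C _ _ z _ (cV z)).
  apply: (@continuousM R C _ _ z _ (cRe z)); exact: cst_continuous.
- under [X in continuous_at _ X]eq_fun do rewrite stereo_inv1.
  apply: (@continuousM R C _ _ z _ (cV z)).
  apply: (@continuousM R C _ _ z _ (cIm z)); exact: cst_continuous.
- under [X in continuous_at _ X]eq_fun do rewrite stereo_inv2.
  apply: (@continuousM R C _ _ z _ (cV z)).
  apply: (@continuousM R C); first exact: cst_continuous.
  apply: (@continuousD R R C); first exact: cD.
  exact: cst_continuous.
Qed.

Lemma stereo_dom_open s : open (stereo_dom s).
Proof.
have -> : stereo_dom s = coord3 (inord 2) @^-1` [set~ s].
  by apply/seteqP; split => x /=; [move/eqP|move/eqP].
apply: open_comp => [x _|]; first exact: coord3_continuous.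
exact/closed_openC/closed_eq.
Qed.

Lemma stereo_continuous s : s ^+ 2 = 1 -> {within stereo_dom s, continuous (stereo s)}.
Proof.
move=> s1; rewrite (continuous_open_subspace _ (stereo_dom_open s)) => x /set_mem dx.
have cV : {for x, continuous (fun x : S => (1 - s * coord3 (inord 2) x)^-1)}.
  apply: (@continuousV R S); first exact: stereo_dom_neq0.
  apply: (@continuousB R R S); first exact: cst_continuous.
  apply: (@continuousM R S); first exact: cst_continuous.
  exact: coord3_continuous.
by apply: (@Complex_cvg R S (fun x => coord3 (inord 0) x / (1 - s * coord3 (inord 2) x)) (fun x => coord3 (inord 1) x / (1 - s * coord3 (inord 2) x)) x); apply: (@continuousM R S _ _ x _ cV); exact: coord3_continuous.
Qed.

Lemma stereo_chart s : s ^+ 2 = 1 -> chart (stereo_dom s) (stereo s).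
Proof.
move=> s1; split; first exact: stereo_dom_open.
exists (stereo_inv s1); split.
- exact: stereo_continuous.
- by apply: continuous_subspaceT; exact: stereo_inv_continuous.
- by move=> x dx; split => //; apply: stereoK; exact/mem_set.
- by move=> z _; split; [exact: stereo_inv_dom|exact: stereo_invK].
Qed.

Let p1 : 1 ^+ 2 = 1 :> R. Proof. by rewrite expr1n. Qed.
Let m1 : (-1) ^+ 2 = 1 :> R. Proof. by rewrite sqrrN expr1n. Qed.

Lemma stereo_dom_cover x : stereo_dom 1 x \/ stereo_dom (-1) x.
Proof.
rewrite /stereo_dom /=; have [->|] := eqVneq (coord3 (inord 2) x) 1; last by left.
by right; rewrite -subr_eq0 opprK -[1 + 1]/(2%:R) pnatr_eq0.
Qed.

Lemma sphere_connected : connected [set: S].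
Proof.
have -> : [set: S] = (stereo_inv p1 @` setT) `|` (stereo_inv m1 @` setT).
  apply/seteqP; split => // x _; have [dx|dx] := stereo_dom_cover x; [left|right].
    by exists (stereo 1 x) => //; apply: stereoK; exact/mem_set.
  by exists (stereo (-1) x) => //; apply: stereoK; exact/mem_set.
apply: connectedU.
- pose x := stereo_inv p1 1; exists x; split; first by exists 1.
  exists (stereo (-1) x) => //; apply: stereoK; apply/mem_set; rewrite /stereo_dom /= stereo_inv2 /=.
  by rewrite expr1n expr0n /= addr0 -[1 + 1]/(2%:R) subrr mulr0 mul0r eq_sym oppr_eq0 oner_eq0.
- apply: connected_continuous_connected; first exact: connected_C.
  by apply: continuous_subspaceT; exact: stereo_inv_continuous.
- apply: connected_continuous_connected; first exact: connected_C.
  by apply: continuous_subspaceT; exact: stereo_inv_continuous.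
Qed.

Lemma sphere_compact : compact [set: S].
Proof.
set A := [set v : 'rV[R]_3 | \sum_i v ord0 i ^+ 2 = 1].
have cA : compact A.
  apply: bounded_closed_compact.
    exists 1; split => // M M1 v Av; rewrite /= in Av *.
    apply: (@le_trans _ _ 1); last exact: ltW.
    rewrite /Num.norm /= mx_normrE; apply/bigmax_leP; split => // -[i j] _ /=.
    rewrite (ord1 i) -(@ler_pXn2r _ 2)// ?nnegrE// expr1n real_normK ?num_real//.
    by rewrite -Av (bigD1 j) //= lerDl sumr_ge0// => k _; exact: sqr_ge0.
  have -> : A = (fun v : 'rV[R]_3 => \sum_i v ord0 i ^+ 2) @^-1` [set 1] by [].
  apply: closed_comp; last exact: closed_eq.
  have h := @continuous_big R 'I_3 +%R 0 xpredT (@add_continuous _) 'rV[R]_3 (index_enum _) (fun i (v : 'rV[R]_3) => v ord0 i ^+ 2).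
  move=> v _; apply: h => i _ {}v.
  by apply: (@continuousM R); exact: coord_continuous.
move=> F FF _.
have [v [Av clv]] := cA (\val @ F) _ (@filterE _ F _ _ (fun x => set_mem (valP x))).
exists (exist (fun x => x \in A) v (mem_set Av)); split => // P Q FP [_ [[W oW <-] Wv WQ]].
have nP : (\val @ F) ((\val : S -> 'rV[R]_3) @` P).
  by apply: (@filterS _ F _ P) => // x Px; exists x.
have [_ [[x Px <-] Wx]] := clv _ W nP (open_nbhs_nbhs (conj oW Wv)).
by exists x; split => //; exact: WQ.
Qed.

Lemma sphere_surface : closed_connected_surface R S.
Proof.
split; [exact: sphere_compact|exact: sphere_connected|exact: sphere_hausdorff|].
move=> x; have [dx|dx] := stereo_dom_cover x.
  by exists (stereo_dom 1), (stereo 1); split => //; exact: stereo_chart.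
by exists (stereo_dom (-1)), (stereo (-1)); split => //; exact: stereo_chart.
Qed.

End sphere_topology.

(* Main.v *)
(* Let [x0], [x1] be the first two marked points, and [W] a homeomorphism of the
   sphere minus [x1] onto the complex plane with [W x0 = 0]. Since [k] divides
   all local degrees over [x0] and [x1], the map [W \o f] has a continuous
   [k]-th root near each puncture, and hence, the sphere being simply connected,
   a global one, [r], off the fibres over [x0] and [x1]. A generic fibre of [f]
   consists of the fibres of [r] over the [k] distinct [k]-th roots of one
   number. The fibres of [r] all have the same cardinality outside a finite set,
   so they have [d / k] points generically. Near a point [p] over another [x i],
   [r] is a local branch of the root of [W \o f], so a fibre of [r] over a value
   near [r p] has at least as many points near [p] as the local degree of [f]
   at [p], and the local degree is at most [d / k]. *)
Require Import Defs.
From mathcomp Require Import all_boot all_order all_algebra.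
From mathcomp Require Import complex ring lra.
From mathcomp Require cyclic separable cyclotomic.
From mathcomp Require Import all_classical all_reals all_analysis.

Set Implicit Arguments.
Unset Strict Implicit.
Unset Printing Implicit Defensive.

Import Order.TTheory GRing.Theory Num.Theory.
Import numFieldNormedType.Exports.

Local Open Scope classical_set_scope.
Local Open Scope ring_scope.

(** * Locally constant functions *)

Section locally_constant.

(* Connectedness in terms of locally constant predicates; unlike [connected], it
   passes readily from an open set to the set minus a point. *)
Definition lconn (X : topologicalType) (A : set X) : Prop :=
  forall Q : set X,
    (forall x, A x -> \forall y \near x, A y -> (Q y <-> Q x)) ->
    forall x y, A x -> A y -> Q x -> Q y.

Lemma lconn_const (X : topologicalType) (A : set X) (T : Type) (g : X -> T) :
  lconn A -> (forall x, A x -> \forall y \near x, A y -> g y = g x) ->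
  forall x y, A x -> A y -> g y = g x.
Proof.
move=> lA gA x y Ax Ay; apply: (lA (fun z => g z = g x) _ x y Ax Ay erefl).
by move=> z /gA; apply: filterS => u gu Au; rewrite gu.
Qed.

(** Local constancy makes [Q] and its complement relatively open in [A]: by [h], each is cut out of
    [A] by the interior of its union with the complement of [A]. So [Q] is relatively clopen in
    [A]. *)
Lemma connected_lconn (X : topologicalType) (A : set X) :
  connected A -> lconn A.
Proof.
move=> cA Q QA x y Ax Ay Qx.
have h (P : set X) : (forall z, A z -> \forall u \near z, A u -> (P u <-> P z)) ->
    A `&` P = A `&` (~` A `|` P)°.
  move=> PA; apply/seteqP; split => z [Az Pz]; split => //.
    by have := PA z Az; apply: filterS => u Pu; have [/Pu Au|] := pselect (A u); [right; apply/Au|left].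
  by case: (nbhs_singleton Pz).
have : A `&` Q = A.
  apply: cA; first by exists x.
    by exists (~` A `|` Q)°; [exact: open_interior|exact: h].
  exists (~` (~` A `|` ~` Q)°).
    exact/open_closedC/open_interior.
  apply/seteqP; split => z [Az Qz]; split => //.
    by move/nbhs_singleton => [].
  apply: contrapT => nQ; apply: Qz.
  have := QA z Az; apply: filterS => u Pu; have [/Pu Au|] := pselect (A u); last by left.
  by right=> /Au.
by move=> AQ; have [] : (A `&` Q) y by rewrite AQ.
Qed.

Lemma lconnU (X : topologicalType) (A B : set X) :
  A `&` B !=set0 -> lconn A -> lconn B -> lconn (A `|` B).
Proof.
move=> [z [Az Bz]] lA lB Q QAB.
have QA x y : A x -> A y -> Q x -> Q y.
  by apply: lA => {}x Ax; have := QAB x (or_introl Ax); apply: filterS => u + Au; apply; left.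
have QB x y : B x -> B y -> Q x -> Q y.
  by apply: lB => {}x Ax; have := QAB x (or_intror Ax); apply: filterS => u + Au; apply; right.
move=> x y [Ax|Bx] [Ay|By_]; [exact: QA|move=> /(QA _ z Ax Az)|move=> /(QB _ z Bx Bz)|exact: QB].
  exact: QB.
exact: QA.
Qed.

(** A locally constant predicate on [A] minus [p] is constant on the connected punctured
    neighbourhood [V] minus [p]; giving [p] this common value extends it to a locally constant
    predicate on [A]. *)
Lemma lconn_puncture (X : topologicalType) (A : set X) (p : X) :
  accessible_space X -> lconn A ->
  (A p -> exists V : set X, [/\ nbhs p V, V `<=` A, lconn (V `\ p) & V `\ p !=set0]) ->
  lconn (A `\ p).
Proof.
move=> X1 lA Ap; have [{}/Ap [V [nV VA lV [v Vv]]]|nAp] := pselect (A p); last first.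
  suff -> : A `\ p = A by [].
  by apply/seteqP; split => x; [case|move=> Ax; split => // xp; apply: nAp; rewrite -xp].
move=> Q QA x y [Ax xp] [Ay yp] Qx.
pose Q' z := if pselect (z = p) then Q v else Q z.
have Q'E z : z <> p -> Q' z = Q z by rewrite /Q'; case: pselect.
have Q'p : Q' p = Q v by rewrite /Q'; case: pselect.
suff : Q' y by rewrite Q'E.
apply: (lA Q' _ x y) => //; last by rewrite Q'E.
move=> z Az; have [->|zp] := pselect (z = p).
  apply: filterS nV => u Vu Au; rewrite Q'p; have [->|up] := pselect (u = p); first by rewrite Q'p.
  rewrite Q'E//; have lQ : forall a, (V `\ p) a -> \forall b \near a, (V `\ p) b -> (Q b <-> Q a).
    move=> a [Va ap]; have := QA a (conj (VA _ Va) ap); apply: filterS => b + [Vb bp].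
    by apply; split => //; exact: VA.
  by split; apply: (lV Q).
rewrite (Q'E z)//.
have nzp : \forall u \near z, u <> p.
  by apply: open_nbhs_nbhs; split; [exact/closed_openC/accessible_closed_set1|].
near=> u => Au; have up : u <> p by near: u.
rewrite Q'E//; have : (A `\ p) u by []; near: u; exact: QA.
Unshelve. all: by end_near. Qed.

End locally_constant.

(** * Connectedness of rectangles and of cofinite subsets of the plane *)

Section plane.
Context {R : realType}.
Local Notation C := (R[i]^o).
Local Notation Re := (@complex.Re R).
Local Notation Im := (@complex.Im R).

(** Open rectangles, possibly empty, are closed under intersection, which keeps overlaps connected
    when roots are glued. *)
Definition rect (a b c d : R) : set C :=
  [set z | [/\ a < Re z, Re z < b, c < Im z & Im z < d]].

Lemma rect_open a b c d : open (rect a b c d).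
Proof.
rewrite openE => z [h1 h2 h3 h4]; near=> w; split; near: w.
- exact: (@Re_continuous R z [set t | a < t] (lt_nbhsr h1)).
- exact: (@Re_continuous R z [set t | t < b] (lt_nbhsl h2)).
- exact: (@Im_continuous R z [set t | c < t] (lt_nbhsr h3)).
- exact: (@Im_continuous R z [set t | t < d] (lt_nbhsl h4)).
Unshelve. all: by end_near.
Qed.

(** By convexity, the predicate can be pulled back to the unit interval along the segment [g] from
    [x] to [y]. *)
Lemma rect_lconn a b c d : lconn (rect a b c d).
Proof.
move=> Q QA x y Ax Ay.
pose g (t : R) : C := Complex (Re x + t * (Re y - Re x)) (Im x + t * (Im y - Im x)).
have g0 : g 0 = x by rewrite /g !mul0r !addr0; case: (x).
have g1 : g 1 = y by rewrite /g !mul1r !subrKC; case: (y).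
have cg : continuous g.
  move=> t; pose segment (u v s : R) := u + s * (v - u).
  by apply: (@Complex_cvg R R (segment (Re x) (Re y)) (segment (Im x) (Im y)) t);
    apply: (@continuousD R R R) => //;
    [exact: cst_continuous|apply: (@continuousM R R); [exact: cvg_id|exact: cst_continuous]
    |exact: cst_continuous|apply: (@continuousM R R); [exact: cvg_id|exact: cst_continuous]].
have gA t : 0 <= t <= 1 -> rect a b c d (g t).
  have L (u v w : R) : u < v -> u < w -> 0 <= t <= 1 -> u < v + t * (w - v).
    by move=> uv uw /andP[t0 t1]; case: (lerP v w) => vw; nra.
  have U (u v w : R) : v < u -> w < u -> 0 <= t <= 1 -> v + t * (w - v) < u.
    by move=> uv uw /andP[t0 t1]; case: (lerP v w) => vw; nra.
  by case: Ax Ay => x1 x2 x3 x4 [y1 y2 y3 y4] t01; split; rewrite /g /=;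
    [apply: L|apply: U|apply: L|apply: U].
move=> Qx; rewrite -g1.
apply: (connected_lconn (@segment_connected R 0 1) (Q := Q \o g) _ (x := 0));
  rewrite /= ?in_itv/= ?lexx ?ler01//.
  move=> t; rewrite in_itv/= => /gA gt.
    have H : nbhs t (g @^-1` [set y | rect a b c d y -> (Q y <-> Q (g t))]) := cg t _ (QA _ gt).
    by apply: filterS H => u /= h; rewrite in_itv/= => /gA/h.
by rewrite g0.
Qed.

Lemma nbhs_rect (z : C) (A : set C) : nbhs z A ->
  exists2 e : R, 0 < e & rect (Re z - e) (Re z + e) (Im z - e) (Im z + e) `<=` A.
Proof.
move=> nA; pose h (p : R * R) : C := Complex p.1 p.2.
have ch : {for (Re z, Im z), continuous h}.
  by apply: Complex_cvg; [exact: cvg_fst|exact: cvg_snd].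
have hz : h (Re z, Im z) = z by case: (z).
have : nbhs (Re z, Im z) (h @^-1` A) by apply: ch; rewrite hz.
move=> /nbhs_ballP [e /= e0 eA]; exists e => // w [w1 w2 w3 w4].
have -> : w = h (Re w, Im w) by case: (w).
by apply: eA; split; rewrite /ball /= ltr_distlC; apply/andP.
Qed.

Lemma nbhs_in_rect (z : C) e : 0 < e -> nbhs z (rect (Re z - e) (Re z + e) (Im z - e) (Im z + e)).
Proof.
move=> e0; apply: open_nbhs_nbhs; split; first exact: rect_open.
by split; rewrite ?ltrBlDr ltrDl.
Qed.

Lemma C_accessible : accessible_space C.
Proof. exact/hausdorff_accessible/norm_hausdorff. Qed.

(** The punctured square is the union of its left, upper, right and lower open halves, and in this
    order each meets the union of the previous ones. *)
Lemma punctured_square_lconn (z : C) e : 0 < e ->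
  lconn (rect (Re z - e) (Re z + e) (Im z - e) (Im z + e) `\ z).
Proof.
move=> e0; set x := Re z; set y := Im z.
have -> : rect (x - e) (x + e) (y - e) (y + e) `\ z =
   ((rect (x - e) x (y - e) (y + e) `|` rect (x - e) (x + e) y (y + e)) `|`
   rect x (x + e) (y - e) (y + e)) `|` rect (x - e) (x + e) (y - e) y.
  apply/seteqP; split => w.
    move=> [[h1 h2 h3 h4] wz].
    have [wx|wx|wx] := ltgtP (Re w) x; first by left; left; left.
      by left; right.
    have [wy|wy|wy] := ltgtP (Im w) y; first by right.
      by left; left; right.
    by exfalso; apply: wz; move: wx wy; rewrite /x /y; case: (w) (z) => ? ? [? ?] /= -> ->.
  have wz : Re w != x \/ Im w != y -> w <> z by move=> h wz; move: h; rewrite wz !eqxx; case.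
  move=> [[[]|]|] [h1 h2 h3 h4]; (split; [by split => //; lra|apply: wz]).
  - by left; rewrite lt_eqF.
  - by right; rewrite gt_eqF.
  - by left; rewrite gt_eqF.
  - by right; rewrite lt_eqF.
have h : e / 2 < e by lra.
have h' : 0 < e / 2 by lra.
apply: lconnU; last exact: rect_lconn.
  exists (Complex (x - e / 2) (y - e / 2)); split; last by split => /=; lra.
  by left; left; split => /=; lra.
apply: lconnU; last exact: rect_lconn.
  exists (Complex (x + e / 2) (y + e / 2)); split; last by split => /=; lra.
  by right; split => /=; lra.
apply: lconnU; [|exact: rect_lconn|exact: rect_lconn].
by exists (Complex (x - e / 2) (y + e / 2)); split; split => /=; lra.
Qed.

Lemma C_puncture (A : set C) (p : C) : open A -> lconn A -> lconn (A `\ p).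
Proof.
move=> oA lA; apply: lconn_puncture => //; first exact: C_accessible.
move=> Ap; have [e e0 eA] := nbhs_rect (open_nbhs_nbhs (conj oA Ap)).
exists (rect (Re p - e) (Re p + e) (Im p - e) (Im p + e)); split => //.
- exact: nbhs_in_rect.
- exact: punctured_square_lconn.
exists (Complex (Re p + e / 2) (Im p)); split; first by split => /=; lra.
by move=> /(congr1 Re) /=; lra.
Qed.

Lemma finite_openC (P : set C) : finite_set P -> open (~` P).
Proof.
move=> fP; apply: closed_openC.
have /accessible_finite_set_closed h := C_accessible; exact: h.
 Qed.

Lemma C_punctures (A P : set C) : open A -> lconn A -> finite_set P -> lconn (A `\` P).
Proof.
move=> oA lA /finite_seqP[s ->]; elim: s => [|p s IH].
  by rewrite set_nil setD0.
have -> : A `\` [set` p :: s] = (A `\` [set` s]) `\ p.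
  by rewrite setDDl setUC; congr (_ `\` _); apply/seteqP; split => x /=; rewrite inE => /predU1P.
by apply: C_puncture => //; apply: openI => //; apply: finite_openC; exact: finite_seq.
Qed.

Lemma lconn_C : lconn [set: C].
Proof. by apply: connected_lconn; exact: connected_C. Qed.

Lemma nbhs_avoid (z : C) (A P : set C) : nbhs z A -> finite_set P ->
  exists w, [/\ A w, w <> z & ~ P w].
Proof.
move=> /nbhs_rect[e e0 eA] fP; apply: contrapT => H.
(* Infinitely many distinct points of the square; starting the denominators at 2 keeps the offset
   strictly between 0 and [e]. *)
pose h (n : nat) : C := Complex (Re z + e / n.+2%:R) (Im z).
have hn n : 0 < e / n.+2%:R < e.
  have n0 : 1 < n.+2%:R :> R by rewrite ltr1n.
  by rewrite divr_gt0//= ltr_pdivrMr// ltr_pMr.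
apply: infinite_nat; have <- : h @^-1` P = setT.
  apply/seteqP; split => // n _; apply: contrapT => Phn; apply: H; exists (h n); split => //.
    apply: eA; have := hn n; rewrite /h; set q := _ / _; clearbody q => /andP[h1 h2].
    by split => /=; lra.
  have := hn n; rewrite /h; set q := _ / _; clearbody q => /andP[h1 h2].
  by move=> /(congr1 Re) /=; lra.
apply: finite_preimage => // n m _ _ /(congr1 Re) /= /addrI/(mulfI (lt0r_neq0 e0))/invr_inj/eqP.
by rewrite eqr_nat => /eqP[].
Qed.

End plane.

(** * Continuous roots on a space: uniqueness and gluing *)

Lemma near_eq_continuous (X Y : topologicalType) (f g : X -> Y) (p : X) :
  (\forall x \near p, f x = g x) -> {for p, continuous f} -> {for p, continuous g}.
Proof.
move=> fg cf U; rewrite -(nbhs_singleton fg) => /cf h.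
by apply: filterS2 fg h => x /= ->.
Qed.

Lemma continuous_near (X Y : topologicalType) (f : X -> Y) (p : X) (A : set Y) :
  {for p, continuous f} -> nbhs (f p) A -> \forall x \near p, A (f x).
Proof. by move=> cf /cf. Qed.

Section roots.
Context {R : realType}.
Local Notation C := (R[i]^o).
Variable k : nat.
Hypothesis k0 : (0 < k)%N.

Lemma finite_pow_eq (c : C) : finite_set [set z : C | z ^+ k = c].
Proof.
pose p : {poly R[i]} := 'X^k - (c : R[i])%:P.
have p0 : p != 0 by rewrite -size_poly_gt0 size_XnsubC.
have [rs rsE] := closed_field_poly_normal p.
apply: (@sub_finite_set _ _ [set` (rs : seq C)]); last exact: finite_seq.
move=> z /= zc; rewrite -root_prod_XsubC -(rootZ _ _ (a := lead_coef p)) ?lead_coef_eq0//.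
by rewrite -rsE /root /p !hornerE [X in X - _]zc subrr.
Qed.

Lemma unity_root_isolated : \forall q \near (1 : C), q ^+ k = 1 -> q = 1.
Proof.
have fP : finite_set ([set z : C | z ^+ k = 1] `\ 1).
  by apply: sub_finite_set (finite_pow_eq 1) => z [].
have : nbhs (1 : C) (~` ([set z : C | z ^+ k = 1] `\ 1)).
  by apply: open_nbhs_nbhs; split; [exact: finite_openC|move=> -[_]; apply].
by move=> H; apply: filterS H => q h q1; apply: contrapT => n1; apply: h.
Qed.

(** [r] is total, with arbitrary values off [A], and its continuity at points of [A] is that of the
    ambient space, so roots restrict to subsets without change. *)
Definition kroot (X : topologicalType) (F : X -> C) (A : set X) : Prop :=
  exists r : X -> C, forall p, A p -> {for p, continuous r} /\ r p ^+ k = F p.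

Lemma kroot_sub (X : topologicalType) (F : X -> C) (A B : set X) :
  B `<=` A -> kroot F A -> kroot F B.
Proof. by move=> BA [r rA]; exists r => p /BA /rA. Qed.

Lemma kroot_neq0 (z c : C) : z ^+ k = c -> c != 0 -> z != 0.
Proof. by move=> <-; apply: contra_neq => ->; rewrite expr0n gtn_eqF. Qed.

(** Divided by its value at [p], the ratio is a continuous function equal to 1 at [p] whose values
    on [A] are roots of unity; these are isolated, so it equals 1 near [p]. *)
Lemma ratio_locally_constant (X : topologicalType) (F : X -> C) (r s : X -> C) (A : set X) :
  (forall p, A p -> F p != 0) ->
  (forall p, A p -> {for p, continuous r} /\ r p ^+ k = F p) ->
  (forall p, A p -> {for p, continuous s} /\ s p ^+ k = F p) ->
  forall p, A p -> \forall u \near p, A u -> r u / s u = r p / s p.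
Proof.
move=> F0 rA sA p Ap.
have [cr rk] := rA p Ap; have [cs sk] := sA p Ap.
have r0 := kroot_neq0 rk (F0 p Ap); have s0 := kroot_neq0 sk (F0 p Ap).
have cq : {for p, continuous (fun u => (r u / s u) / (r p / s p) : C)}.
  apply: (@continuousM R[i] X _ (fun=> _)); last exact: cst_continuous.
  by apply: (@continuousM R[i] X _ _ p cr); exact: (@continuousV R[i] X).
have q1 : (r p / s p) / (r p / s p) = 1 by rewrite divff// mulf_neq0// invr_neq0.
have /(continuous_near cq) H : nbhs (r p / s p / (r p / s p)) [set q : C | q ^+ k = 1 -> q = 1].
  by rewrite q1; exact: unity_root_isolated.
apply: filterS H => u /= h Au.
have [_ ruk] := rA u Au; have [_ suk] := sA u Au.
suff /h e : (r u / s u / (r p / s p)) ^+ k = 1.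
  by rewrite -[LHS](divfK (x := r p / s p)) ?e ?mul1r// mulf_neq0// invr_neq0.
by rewrite !(exprMn, exprVn) ruk suk rk sk !divff ?mulr1 ?F0.
Qed.

Lemma roots_differ_by_unity (X : topologicalType) (F : X -> C) (r s : X -> C) (A : set X) :
  lconn A -> (forall p, A p -> F p != 0) ->
  (forall p, A p -> {for p, continuous r} /\ r p ^+ k = F p) ->
  (forall p, A p -> {for p, continuous s} /\ s p ^+ k = F p) ->
  exists2 w : C, w ^+ k = 1 & forall p, A p -> r p = w * s p.
Proof.
move=> lA F0 rA sA; have [[p Ap]|nA] := pselect (A !=set0); last first.
  by exists 1 => [|p Ap]; [rewrite expr1n|exfalso; apply: nA; exists p].
have H := @lconn_const _ _ _ (fun u => r u / s u) lA (ratio_locally_constant F0 rA sA).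
exists (r p / s p).
  by rewrite exprMn exprVn (rA p Ap).2 (sA p Ap).2 divff// F0.
move=> u Au; rewrite -(H p u Ap Au) divfK//.
exact: kroot_neq0 (sA u Au).2 (F0 u Au).
Qed.

(** On the connected overlap the two roots differ by a constant root of unity; multiplying one of
    them by it makes them agree. *)
Lemma kroot_glue (X : topologicalType) (F : X -> C) (A B : set X) :
  open A -> open B -> lconn (A `&` B) -> (forall p, (A `&` B) p -> F p != 0) ->
  kroot F A -> kroot F B -> kroot F (A `|` B).
Proof.
move=> oA oB lAB F0 [r rA] [s sB].
have [w wk rs] : exists2 w : C, w ^+ k = 1 & forall p, (A `&` B) p -> r p = w * s p.
  by apply: (roots_differ_by_unity lAB F0) => p [Ap Bp]; [exact: rA|exact: sB].
exists (fun z => if z \in A then r z else w * s z) => p ABp.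
have [/set_mem Ap|/negP nAp] := boolP (p \in A).
  split; last exact: (rA p Ap).2.
  apply: near_eq_continuous (rA p Ap).1.
  by apply: filterS (open_nbhs_nbhs (conj oA Ap)) => z /mem_set ->.
have Bp : B p by case: ABp => // /mem_set.
split; last by rewrite exprMn wk mul1r (sB p Bp).2.
apply: (@near_eq_continuous _ _ (fun z => w * s z)).
  apply: filterS (open_nbhs_nbhs (conj oB Bp)) => z Bz.
  by case: ifPn => // /set_mem Az; rewrite rs.
apply: (@continuousM R[i] X (fun=> _)); first exact: cst_continuous.
exact: (sB p Bp).1.
Qed.

End roots.
(** * Roots on the punctured plane *)

Section planar_roots.
Context {R : realType}.
Local Notation C := (R[i]^o).
Local Notation Re := (@complex.Re R).
Local Notation Im := (@complex.Im R).

(** A supremum argument: if [E] is the set of [y <= b] with [Q a y], the local interval around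
    [sup E] can be glued on and reaches beyond [sup E], so beyond [b]. Empty intervals, with right
    end at most [a], come from shrinking a local one. *)
Lemma interval_induction (Q : R -> R -> Prop) :
  (forall a b a' b', a <= a' -> b' <= b -> Q a b -> Q a' b') ->
  (forall a b a' b', a <= a' -> a' < b -> b <= b' -> Q a b -> Q a' b' -> Q a b') ->
  (forall y, exists2 e, 0 < e & Q (y - e) (y + e)) ->
  forall a b, Q a b.
Proof.
move=> Qsub Qglue Qloc a b.
have Qaa y : y <= a -> Q a y.
  move=> ya; have [e e0] := Qloc a; apply: Qsub; first by rewrite lerBlDr lerDl ltW.
  by apply: (le_trans ya); rewrite lerDl ltW.
have [ab|ba] := lerP a b; last exact/Qaa/ltW.
pose E : set R := [set y | Q a y /\ y <= b].
have Ea : E a by split => //; exact: Qaa.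
have Eb : ubound E b by move=> y [].
have sE : has_sup E by split; [exists a|exists b].
have [e e0 Qe] := Qloc (sup E).
have [y [Qay yb] ye] := sup_adherent e0 sE.
have ys : y <= sup E by apply: ub_le_sup => //; exists b.
have Qs : Q a (sup E + e).
  have [ya|ay] := lerP y a.
    by apply: Qsub Qe => //; lra.
  (* The local interval is first cut at [a], since gluing asks the second left end to be at least
     the first. *)
  apply: (Qglue a y (Num.max a (sup E - e))) => //.
  - by rewrite le_max lexx.
  - by rewrite gt_max ay.
  - by lra.
  - by apply: Qsub Qe => //; rewrite le_max lexx orbT.
have [sb|bs] := lerP (sup E + e) b.
  have : sup E + e <= sup E by apply: ub_le_sup; [exists b|].
  by lra.
by apply: Qsub Qs => //; exact: ltW.
Qed.

Variables (k : nat) (F : C -> C) (P : set C).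
Hypotheses (k0 : (0 < k)%N) (fP : finite_set P) (F0 : forall z, ~ P z -> F z != 0).
(** At a point of [P] this is the absence of monodromy of the root around the puncture. *)
Hypothesis F_loc : forall z : C, exists2 U : set C, nbhs z U & kroot k F (U `\` P).

Let punctured_open (A : set C) : open A -> open (A `\` P).
Proof. by move=> oA; apply: openI => //; exact: finite_openC. Qed.

(** The overlap is again a rectangle minus a finite set, hence connected, and [kroot_glue]
    applies. *)
Lemma kroot_glue_rect (a b c d a1 b1 c1 d1 a2 b2 c2 d2 : R) :
  rect a b c d `<=` rect a1 b1 c1 d1 `|` rect a2 b2 c2 d2 ->
  kroot k F (rect a1 b1 c1 d1 `\` P) -> kroot k F (rect a2 b2 c2 d2 `\` P) ->
  kroot k F (rect a b c d `\` P).
Proof.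
move=> s r1 r2; apply: (@kroot_sub _ _ _ _ (rect a1 b1 c1 d1 `\` P `|` rect a2 b2 c2 d2 `\` P)).
  by move=> z [/s[]rz Pz]; [left|right].
apply: kroot_glue r1 r2 => //; try by apply: punctured_open; exact: rect_open.
- have -> (A B : set C) : (A `\` P) `&` (B `\` P) = (A `&` B) `\` P.
    by rewrite !setDE setIACA setIid.
  suff -> : rect a1 b1 c1 d1 `&` rect a2 b2 c2 d2 =
      rect (Num.max a1 a2) (Num.min b1 b2) (Num.max c1 c2) (Num.min d1 d2).
    by apply: C_punctures => //; [exact: rect_open|exact: rect_lconn].
  apply/seteqP; split => z /=.
    by move=> [[? ? ? ?] [? ? ? ?]]; split; rewrite ?gt_max ?lt_min; apply/andP.
  by rewrite /rect /= !gt_max !lt_min => -[/andP[? ?] /andP[? ?] /andP[? ?] /andP[? ?]]; split.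
- by move=> p [[_ /F0]].
Qed.

Lemma kroot_rect : forall a b c d : R, kroot k F (rect a b c d `\` P).
Proof.
have sub (a b c d a' b' c' d' : R) : a <= a' -> b' <= b -> c <= c' -> d' <= d ->
    kroot k F (rect a b c d `\` P) -> kroot k F (rect a' b' c' d' `\` P).
  move=> aa bb cc dd; apply: kroot_sub => z [[z1 z2 z3 z4] Pz]; split => //.
  by split; [exact: le_lt_trans z1|exact: lt_le_trans bb|exact: le_lt_trans z3|exact: lt_le_trans dd].
move=> a b c d; move: a b; apply: interval_induction => [a b a' b' aa bb|a b a' b' aa ab bb r1 r2|x].
- exact: sub.
- apply: (@kroot_glue_rect _ _ _ _ a b c d a' b' c d _ r1 r2) => z [z1 z2 z3 z4].
  by have [h|h] := ltrP (Re z) b; [left|right; split => //; exact: lt_le_trans h].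
(* The outer induction runs over the horizontal side; its local step at [x] is an inner induction
   over the vertical side. The width [e] of the strip may shrink at each gluing, so it is quantified
   inside the predicate. *)
move: c d; apply: (@interval_induction (fun c d => exists2 e, 0 < e &
    kroot k F (rect (x - e) (x + e) c d `\` P))) =>
    [c d c' d' cc dd [e e0 re]|c d c' d' cc cd dd [e e0 re] [f f0 rf]|y].
- by exists e => //; exact: sub re.
- exists (Num.min e f); first by rewrite lt_min e0.
  apply: (@kroot_glue_rect _ _ _ _ _ _ c d _ _ c' d' _ re rf) => z [z1 z2 z3 z4].
  have [me mf] : Num.min e f <= e /\ Num.min e f <= f by rewrite !ge_min !lexx orbT.
  have [h|h] := ltrP (Im z) d; [left|right]; split => //; lra.
have [U nU rU] := F_loc (Complex x y : C).
have [e e0 eU] := nbhs_rect nU; exists e => //; exists e => //.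
by apply: kroot_sub rU => z [/eU Uz Pz].
Qed.

(* Roots on growing squares, normalised to agree at a base point, agree on
   overlaps. *)
Lemma kroot_plane : kroot k F (~` P).
Proof.
have [[z0 Pz0]|nP] := pselect (exists z, ~ P z); last first.
  by exists (fun=> 0) => z Pz; exfalso; apply: nP; exists z.
pose A (n : nat) : set C := rect (- n%:R) n%:R (- n%:R) n%:R.
have subA n m : (n <= m)%N -> A n `<=` A m.
  by rewrite -(ler_nat R) => nm z [z1 z2 z3 z4]; split; lra.
have exA z : exists n, A n z.
  exists (Num.truncn (`|Re z| + `|Im z|)).+1.
  have h : `|Re z| + `|Im z| < (Num.truncn (`|Re z| + `|Im z|)).+1%:R.
    by rewrite truncnS_gt.
  have := ler_norm (Re z); have := ler_norm (Im z); have := ler_norm (- Re z); have := ler_norm (- Im z).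
  by rewrite !normrN; split; have := normr_ge0 (Re z); have := normr_ge0 (Im z); lra.
have [N AN] := exA z0.
have /choice[r rP] n : exists r : C -> C,
    forall p, (A n `\` P) p -> {for p, continuous r} /\ r p ^+ k = F p.
  exact: kroot_rect.
have r0 n : (N <= n)%N -> r n z0 != 0.
  move=> Nn; apply: (@kroot_neq0 _ k k0 _ (F z0)); last exact: F0.
  by apply: (rP n _ _).2; split => //; exact: subA AN.
pose s n z := r (n + N)%N z * (r N z0 / r (n + N)%N z0).
have sP n p : (A (n + N)%N `\` P) p -> {for p, continuous (s n)} /\ s n p ^+ k = F p.
  move=> Ap; have [c e] := rP _ _ Ap; split.
    exact: (@continuousM R[i] C _ (fun=> r N z0 / r (n + N)%N z0) p c (@cst_continuous C C _ p)).
  have Nn : (N <= n + N)%N by rewrite leq_addl.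
  rewrite !exprMn exprVn e (rP _ z0 _).2; last by split.
  rewrite (rP _ z0 _).2; last by split => //; exact: subA AN.
  by rewrite divff ?mulr1// F0.
have sE n m p : (n <= m)%N -> (A (n + N)%N `\` P) p -> s m p = s n p.
  move=> nm Ap; have nmN : (n + N <= m + N)%N by rewrite leq_add2r.
  have lA : lconn (A (n + N)%N `\` P).
    by apply: C_punctures => //; [exact: rect_open|exact: rect_lconn].
  have sAm q : (A (n + N)%N `\` P) q -> {for q, continuous (s m)} /\ s m q ^+ k = F q.
    by move=> [Aq Pq]; apply: sP; split => //; exact: subA Aq.
  have Az0 : (A (n + N)%N `\` P) z0 by split => //; apply: subA AN; rewrite leq_addl.
  have [w wk ws] := roots_differ_by_unity k0 lA (fun q Aq => F0 Aq.2) sAm (sP n).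
  have sz0 j : s j z0 = r N z0 by rewrite /s mulrC divfK// r0// leq_addl.
  have := ws _ Az0; rewrite !sz0 -{1}[r N z0]mul1r => /(mulIf (r0 N (leqnn N))) w1.
  by rewrite ws// -w1 mul1r.
have /choice[n nP] : forall z, exists n, A (n + N)%N z.
  by move=> z; have [n An] := exA z; exists n; apply: subA An; rewrite leq_addr.
(* The index [n z] is chosen point by point; by [sE] the result agrees near [p] with the single root
   [s (n p)]. *)
exists (fun z => s (n z) z) => p Pp; split; last by apply: (sP _ _ _).2.
apply: (@near_eq_continuous _ _ (s (n p))); last by apply: (sP _ _ _).1.
have : nbhs p (A (n p + N)%N `\` P).
  by apply: open_nbhs_nbhs; split => //; apply: punctured_open; exact: rect_open.
move=> H; apply: filterS H => z Az.
have [h|h] := leqP (n z) (n p); first by apply: sE => //; split => //; exact: Az.2.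
by apply/esym/sE => //; exact: ltnW.
Qed.

End planar_roots.
(** * The complex exponential and roots near a puncture *)

Section complex_exponential.
Context {R : realType}.
Local Notation C := (R[i]^o).
Local Notation Re := (@complex.Re R).
Local Notation Im := (@complex.Im R).

Definition cexp (u : C) : C :=
  Complex (expR (Re u) * cos (Im u)) (expR (Re u) * sin (Im u)).

Lemma cexpD (u v : C) : cexp (u + v) = cexp u * cexp v.
Proof.
case: u v => [a b] [c d]; rewrite /cexp /= expRD cosD sinD.
by apply/eqP; rewrite eq_complex /=; apply/andP; split; apply/eqP; ring.
Qed.

Lemma cexp0 : cexp 0 = 1.
Proof. by rewrite /cexp /= expR0 cos0 sin0 !mul1r. Qed.

Lemma cexpMn (u : C) n : cexp (u *+ n) = cexp u ^+ n.
Proof. by elim: n => [|n IH]; rewrite ?mulr0n ?cexp0// mulrS cexpD IH exprS. Qed.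

Lemma cexp_neq0 (u : C) : cexp u != 0.
Proof.
apply/negP => /eqP u0; have : cexp (u + - u) = 0 by rewrite cexpD u0 mul0r.
by rewrite subrr cexp0 => /eqP; rewrite oner_eq0.
Qed.

Lemma cexp_continuous : continuous cexp.
Proof.
move=> u; have ce : {for u, continuous (fun u : C => expR (Re u))}.
  by apply: continuous_comp; [exact: Re_continuous|exact: continuous_expR].
apply: (@Complex_cvg R C (fun u => expR (Re u) * cos (Im u)) (fun u => expR (Re u) * sin (Im u)) u).
  apply: (@continuousM R C) => //.
  by apply: continuous_comp; [exact: Im_continuous|exact: continuous_cos].
apply: (@continuousM R C) => //.
by apply: continuous_comp; [exact: Im_continuous|exact: continuous_sin].
Qed.

Definition period : C := Complex 0 (pi *+ 2).

Lemma cexp_period : cexp period = 1.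
Proof. by rewrite /cexp /= expR0 cos2pi sin2pi mulr1 mulr0. Qed.

(** Reducing [b] modulo the period gives [c] in [[0, 2 pi)] with [sin (c / 2) = 0], while the sine
    is positive on [(0, pi)]; so [c = 0]. *)
Lemma cos_eq1 (b : R) : cos b = 1 -> exists n : int, b = (pi *+ 2) *~ n.
Proof.
have p2 : 0 < pi *+ 2 :> R by rewrite mulrn_wgt0// pi_gt0.
move=> b1; pose n := Num.floor (b / (pi *+ 2)); exists n.
pose c := b - (pi *+ 2) *~ n.
have c0 : 0 <= c.
  by rewrite subr_ge0 -mulrzr mulrC -ler_pdivlMr// floor_le_tmp.
have c2 : c < pi *+ 2.
  have := floorD1_gt (b / (pi *+ 2)); rewrite ltr_pdivrMr// intrD mulrDl mul1r mulrC mulrzr => h.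
  by rewrite /c ltrBlDr addrC.
have c1 : cos c = 1.
  rewrite -b1 /c; case: (n) => m.
    rewrite -pmulrn -[in RHS](subrK (pi *+ 2 *+ m) b).
    by rewrite (periodicn (@cosD2pi R)).
  by rewrite NegzE mulrNz opprK -pmulrn (periodicn (@cosD2pi R)).
have : sin (c / 2) = 0.
  apply/eqP; rewrite -sqrf_eq0; apply/eqP.
  have : cos ((c / 2) *+ 2) = 1 by rewrite -mulr_natr divfK.
  by rewrite cos_mulr2n; have := cos2Dsin2 (c / 2); lra.
have [cp|c_le _] := ltrP 0 c; last first.
  by apply/eqP; rewrite -subr_eq0 -/c eq_le c0 c_le.
have /sin_gt0_pi : 0 < c / 2 < pi by rewrite divr_gt0//= ltr_pdivrMr// mulr_natr.
by move=> /lt0r_neq0/eqP.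
Qed.

Lemma cexp_eq1 (u : C) : cexp u = 1 -> exists n : int, u = period *~ n.
Proof.
case: u => a b; rewrite /cexp /= => /eqP; rewrite eq_complex /= => /andP[/eqP h1 /eqP h2].
have e1 : expR a = 1.
  have : expR a ^+ 2 = 1.
    have -> : expR a ^+ 2 = (expR a * cos b) ^+ 2 + (expR a * sin b) ^+ 2.
      by rewrite !exprMn -mulrDr cos2Dsin2 mulr1.
    by rewrite h1 h2 expr1n expr0n addr0.
  move=> /eqP; rewrite sqrf_eq1 => /orP[/eqP//|/eqP e].
  by have := expR_gt0 a; rewrite e; lra.
have a0 : a = 0 by rewrite -(expRK a) e1 ln1.
rewrite e1 mul1r in h1; have [n bn] := cos_eq1 h1; exists n.
have pz m : period *+ m = Complex 0 (pi *+ 2 *+ m).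
  elim: m => [|m IH]; first by rewrite !mulr0n.
  have pS : pi *+ 2 *+ m.+1 = pi *+ 2 + pi *+ 2 *+ m :> R by exact: mulrS.
  by rewrite mulrS IH pS; apply/eqP; rewrite eq_complex /= addr0 !eqxx.
rewrite a0 bn; case: (n) => m; first by rewrite -!pmulrn pz.
rewrite NegzE !mulrNz -!pmulrn pz.
by apply/eqP; rewrite eq_complex /= oppr0 !eqxx.
Qed.

(** Descent through the exponential, whose fibres are cosets of the group generated by [period]. *)
Lemma cexp_factor (T : Type) (t : C -> T) : (forall u, t (u + period) = t u) ->
  forall u v, cexp u = cexp v -> t u = t v.
Proof.
move=> tp u v uv.
have : cexp (u - v) = 1.
  by rewrite cexpD uv -cexpD subrr cexp0.
move=> /cexp_eq1[n]; move=> /eqP; rewrite subr_eq addrC => /eqP ->.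
have tn w m : t (w + period *+ m) = t w.
  by elim: m => [|m IH]; rewrite ?mulr0n ?addr0// mulrSr addrA tp.
case: n => m; first by rewrite -pmulrn tn.
by rewrite NegzE mulrNz -pmulrn -(tn (v - _) m.+1) subrK.
Qed.

(* A branch of the logarithm on [Re z > 0]: there [|z| = Re z / cos (arg z)]. *)
Definition clog (z : C) : C :=
  Complex (ln (Re z / cos (atan (Im z / Re z)))) (atan (Im z / Re z)).

Lemma cos_atan_gt0 (x : R) : 0 < cos (atan x).
Proof. by apply: cos_gt0_pihalf; rewrite atan_gtNpi2 atan_ltpi2. Qed.

Lemma clogK (z : C) : 0 < Re z -> cexp (clog z) = z.
Proof.
case: z => x y /= x0; rewrite /cexp /=; have c0 := cos_atan_gt0 (y / x).
rewrite lnK ?posrE ?divr_gt0// divfK ?gt_eqF//.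
have -> // : x / cos (atan (y / x)) * sin (atan (y / x)) = y.
have := atanK (y / x); rewrite /tan => h.
by rewrite -mulrA [_^-1 * _]mulrC h mulrC divfK// gt_eqF.
Qed.

Lemma clog_continuous (z : C) : 0 < Re z -> {for z, continuous clog}.
Proof.
move=> z0; have cq : {for z, continuous (fun z : C => Im z / Re z)}.
  apply: (@continuousM R C); first exact: Im_continuous.
  by apply: (@continuousV R C); [rewrite gt_eqF|exact: Re_continuous].
have ca : {for z, continuous (fun z : C => atan (Im z / Re z))}.
  by apply: (continuous_comp cq); exact: continuous_atan.
apply: (@Complex_cvg R C (fun z => ln (Re z / cos (atan (Im z / Re z))))
  (fun z => atan (Im z / Re z)) z) => //.
have cr : {for z, continuous (fun z : C => Re z / cos (atan (Im z / Re z)))}.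
  apply: (@continuousM R C); first exact: Re_continuous.
  apply: (@continuousV R C); first by rewrite gt_eqF// cos_atan_gt0.
  by apply: (continuous_comp ca); exact: continuous_cos.
apply: (continuous_comp cr); apply: continuous_ln.
by rewrite divr_gt0// cos_atan_gt0.
Qed.

(** Powers of [i] rotate any nonzero number into the right half-plane, where [clog] is a logarithm,
    and the image of [cexp] is stable under multiplication by [i]. *)
Lemma cexp_surj (c : C) : c != 0 -> exists u, cexp u = c.
Proof.
pose i : C := Complex 0 1.
have Gi : cexp (Complex 0 (pi / 2)) = i.
  by rewrite /cexp /= expR0 cos_pihalf sin_pihalf mulr0 mulr1.
have G z : (exists u, cexp u = z) -> exists u, cexp u = z * i.
  by move=> [u <-]; exists (u + Complex 0 (pi / 2)); rewrite cexpD Gi.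
have Gp z : 0 < Re z -> exists u, cexp u = z by move=> /clogK; exists (clog z).
case: c => x y c0.
have [x0|x0|x0] := ltgtP x 0; last 1 first.
- have [y0|y0|y0] := ltgtP y 0.
  + have -> : Complex x y = Complex (- y) x * i * i * i.
      by apply/eqP; rewrite eq_complex /=; apply/andP; split; apply/eqP; ring.
    by apply/G/G/G/Gp; rewrite /= oppr_gt0.
  + have -> : Complex x y = Complex y (- x) * i.
      by apply/eqP; rewrite eq_complex /=; apply/andP; split; apply/eqP; ring.
    by apply: G; exact: Gp.
  + by move: c0; rewrite x0 y0 eqxx.
- have -> : Complex x y = Complex (- x) (- y) * i * i.
    by apply/eqP; rewrite eq_complex /=; apply/andP; split; apply/eqP; ring.
  by apply/G/G/Gp; rewrite /= oppr_gt0.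
- exact: Gp.
Qed.

Lemma nbhs_div_gt0 (c : C) : c != 0 -> \forall z \near c, 0 < Re (z / c : C).
Proof.
move=> c0; have cd : {for c, continuous (fun z : C => z / c : C)}.
  by apply: (@continuousM R[i] C); [exact: cvg_id|exact: cst_continuous].
apply: (continuous_near (A := [set w : C | 0 < Re w]) cd).
rewrite /= divff//; apply: (@Re_continuous R 1 [set t | 0 < t]).
by apply: lt_nbhsr; exact: ltr01.
Qed.

Lemma div_continuous (c z : C) : {for z, continuous (fun w : C => w / c : C)}.
Proof. by apply: (@continuousM R[i] C); [exact: cvg_id|exact: cst_continuous]. Qed.

Lemma power_continuous n : continuous (fun z : C => z ^+ n : C).
Proof.
elim: n => [|n IH] z; first exact: cst_continuous.
have -> : (fun z : C => z ^+ n.+1) = (fun z => z * z ^+ n) by apply/funext => w; rewrite exprS.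
by apply: (@continuousM R[i] C) (IH z); exact: cvg_id.
Qed.

Variable k : nat.
Hypothesis k0 : (0 < k)%N.

(** Near [p] the quotient [F q / F p] lies in the right half-plane; the root is a fixed root of
    [F p] times the exponential of [clog (F q / F p) / k]. *)
Lemma kroot_local (X : topologicalType) (F : X -> C) (p : X) :
  (\forall q \near p, {for q, continuous F}) -> F p != 0 ->
  exists2 U : set X, nbhs p U & kroot k F U.
Proof.
move=> cF F0; pose c := F p.
exists [set q | {for q, continuous F} /\ 0 < Re (F q / c : C)].
  have H := continuous_near (A := [set w : C | 0 < Re (w / c : C)])
    (nbhs_singleton cF) (nbhs_div_gt0 F0).
  by apply: filterS2 cF H => q.
have a_k : (k.-root (c : R[i]) : C) ^+ k = c by exact: rootCK.
exists (fun q => k.-root (c : R[i]) * cexp (clog (F q / c) * k%:R^-1)) => q [cq q0].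
split; last first.
  have e (u : R[i]) : u / k%:R *+ k = u by rewrite -mulr_natr divfK// pnatr_eq0 lt0n_neq0.
  rewrite exprMn a_k -cexpMn; have -> := congr1 cexp (e (clog (F q / c))).
  by rewrite clogK// mulrC divfK.
apply: (@continuousM R[i] X (fun=> _)); first exact: cst_continuous.
have cl : {for q, continuous (fun q => clog (F q / c))}.
  have cd := @continuous_comp X C C F (fun w => w / c) q cq (@div_continuous c _).
  exact: (@continuous_comp X C C (fun q => F q / c) clog q cd (clog_continuous q0)).
apply: (@continuous_comp X C C (fun q => clog (F q / c) / k%:R) cexp q _ (@cexp_continuous _)).
exact: (@continuous_comp X C C (fun q => clog (F q / c)) (fun w => w / k%:R) q cl
  (@div_continuous k%:R _)).
Qed.

(* Pull [h] back by the exponential and take a root [s] there. Then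
   [s (u + 2 i pi) = w * s u] with [w ^+ k = 1], so that [s (u *+ k)] is
   periodic and descends to a root of [h (z ^+ k)]. *)
Lemma kroot_power (h : C -> C) :
  (forall z : C, z != 0 -> {for z, continuous h} /\ h z != 0) ->
  kroot k (fun z : C => h (z ^+ k)) [set~ 0].
Proof.
move=> hP; have H0 u : h (cexp u) != 0 by have [] := hP _ (cexp_neq0 u).
have cH : continuous (h \o cexp).
  move=> u; apply: continuous_comp; first exact: cexp_continuous.
  by have [] := hP _ (cexp_neq0 u).
have [s sP] : kroot k (h \o cexp) (~` set0).
  apply: kroot_plane => [||z _|z]; [exact: k0|exact: finite_set0|exact: H0|].
  have [U nU rU] := @kroot_local C (h \o cexp) z (@filterE _ (nbhs z) _ _ cH) (H0 z).
  by exists U => //; apply: kroot_sub rU => ? [].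
have {}sP u : {for u, continuous s} /\ s u ^+ k = h (cexp u) by exact: sP.
have s'P u : {for u, continuous (fun u => s (u + period))} /\ s (u + period) ^+ k = h (cexp u).
  split; last by rewrite (sP _).2 cexpD cexp_period mulr1.
  apply: (@continuous_comp C C C (fun u => u + period) s u _ (sP _).1).
  by apply: (@continuousD R[i] C C); [exact: cvg_id|exact: cst_continuous].
have [w wk ws] := roots_differ_by_unity k0 (@lconn_C R)
  (fun u _ => H0 u) (fun u _ => s'P u) (fun u _ => sP u).
have sw u n : s (u + period *+ n) = w ^+ n * s u.
  elim: n => [|n IH]; first by rewrite mulr0n addr0 mul1r.
  by rewrite mulrSr addrA ws// IH exprS mulrA.
pose t (u : C) : C := s (u *+ k).
have tE := @cexp_factor _ t (fun u => etrans (congr1 s (mulrnDl _ _ _)) (etrans (sw _ k) _)).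
have {}tE u v : cexp u = cexp v -> t u = t v.
  by apply: tE => {}u; rewrite wk mul1r.
have /choice[lg lgP] : forall z : C, exists u, z != 0 -> cexp u = z.
  move=> z; have [->|/cexp_surj[u <-]] := eqVneq z 0; first by exists 0.
  by exists u.
exists (fun z => t (lg z)) => z /eqP z0; split; last by rewrite /t (sP _).2 cexpMn lgP.
(* The chosen logarithm [lg] need not be continuous, but [t] only depends on the exponential of its
   argument, so near [z] it may be replaced by a continuous logarithm of [y]. *)
apply: (@near_eq_continuous C C (fun y : C => t (clog (y / z) + lg z))).
  have H := nbhs_div_gt0 z0; apply: filterS H => y y0; apply: tE.
  have yz : y / z != 0.
    by apply: contraTneq y0 => ->; rewrite ltxx.
  rewrite cexpD clogK// lgP// divfK// lgP//.
  by apply: contra_neq yz => ->; rewrite mul0r.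
have cl : {for z, continuous (fun y : C => clog (y / z) + lg z : C)}.
  apply: (@continuousD R[i] C C); last exact: cst_continuous.
  apply: (@continuous_comp C C C (fun y => y / z) clog z (@div_continuous z z)).
  by apply: clog_continuous; rewrite divff//; exact: ltr01.
apply: (@continuous_comp C C C _ t z cl); set u0 := _ + _.
exact: (@continuous_comp C C C (fun u => u *+ k) s u0 (@natmul_continuous _ C k u0) (sP _).1).
Qed.

End complex_exponential.
(** * Charts on the punctured sphere *)

Section sphere_charts.
Context {R : realType}.
Local Notation C := (R[i]^o).
Local Notation S := (sphere R).

Definition dot (v w : 'rV[R]_3) : R := \sum_i v ord0 i * w ord0 i.

Lemma dotC v w : dot v w = dot w v.
Proof. by apply: eq_bigr => i _; rewrite mulrC. Qed.

Lemma dotBl v1 v2 w : dot (v1 - v2) w = dot v1 w - dot v2 w.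
Proof. by rewrite /dot -sumrB; apply: eq_bigr => i _; rewrite !mxE mulrBl. Qed.

Lemma dotBr v1 v2 w : dot w (v1 - v2) = dot w v1 - dot w v2.
Proof. by rewrite dotC dotBl !(dotC w). Qed.

Lemma dotZl a v w : dot (a *: v) w = a * dot v w.
Proof. by rewrite /dot big_distrr /=; apply: eq_bigr => i _; rewrite !mxE mulrA. Qed.

Lemma dotZr a v w : dot w (a *: v) = a * dot w v.
Proof. by rewrite dotC dotZl dotC. Qed.

Lemma dot_gt0 v : v != 0 -> dot v v != 0.
Proof.
apply: contra_neq => /eqP.
rewrite psumr_eq0 => [|i _]; last by rewrite -expr2 sqr_ge0.
move=> /allP h; apply/rowP => i; rewrite mxE; apply/eqP.
by rewrite -sqrf_eq0 expr2; apply: h; rewrite mem_index_enum.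
Qed.

Definition reflect (u v : 'rV[R]_3) : 'rV[R]_3 := v - (2 * dot v u / dot u u) *: u.

Lemma reflectK u : u != 0 -> involutive (reflect u).
Proof.
move=> /dot_gt0 u0 v; rewrite {1}/reflect.
have -> : dot (reflect u v) u = - dot v u.
  by rewrite /reflect dotBl dotZl divfK//; ring.
by rewrite /reflect mulrN mulNr scaleNr opprK subrK.
Qed.

Lemma dot_reflect u v : u != 0 -> dot (reflect u v) (reflect u v) = dot v v.
Proof.
move=> /dot_gt0 u0; rewrite /reflect !(dotBl, dotBr, dotZl, dotZr) (dotC u v).
by set a := dot v u; set s := dot u u in u0 *; field.
Qed.

Lemma sphere_dot (x : S) : dot (\val x) (\val x) = 1.
Proof. by have /set_mem /= := valP x; rewrite /dot; under eq_bigr do rewrite expr2. Qed.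

Lemma reflect_sphere u (x : S) : u != 0 ->
  reflect u (\val x) \in [set v : 'rV[R]_3 | \sum_i v ord0 i ^+ 2 = 1].
Proof.
move=> u0; apply/mem_set => /=.
apply: etrans (sphere_dot x); rewrite -(dot_reflect _ u0); apply: eq_bigr => i _.
by rewrite expr2.
Qed.

(** For distinct points, the reflection in the plane orthogonal to [p - q] exchanges the two unit
    vectors. *)
Lemma sphere_reflection (p q : S) : exists2 h : S -> S, continuous h & involutive h /\ h p = q.
Proof.
have [->|pq] := eqVneq p q; first by exists id => // x; exact: cvg_id.
pose u := \val p - \val q.
have u0 : u != 0 by rewrite subr_eq0; apply: contra_neq pq => /val_inj.
pose h (x : S) : S :=
  exist (fun v => v \in [set v : 'rV[R]_3 | \sum_i v ord0 i ^+ 2 = 1]) _ (reflect_sphere x u0).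
have hE x : \val (h x) = reflect u (\val x) by [].
exists h; last first.
  split=> [x|]; apply/val_inj; rewrite !hE; first by rewrite reflectK.
  (* As [p] and [q] are unit vectors, both [2 * dot p u] and [dot u u] equal [2 - 2 * dot p q]. *)
  rewrite /reflect; suff -> : 2 * dot (\val p) u / dot u u = 1.
    by rewrite scale1r /u subKr.
  have := dot_gt0 u0; rewrite /u !(dotBl, dotBr) !sphere_dot (dotC (\val q)).
  by set c := dot _ _ => c0; field; apply: contra_neq c0 => c1; rewrite -c1; ring.
apply: sphere_continuous => i x.
have -> : (fun y => coord3 i (h y)) =
    (fun y => coord3 i y - 2 / dot u u * u ord0 i * dot (\val y) u).
  by apply/funext => y; rewrite /coord3 hE !mxE; ring.
apply: (@continuousB R R S); first exact: coord3_continuous.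
apply: (@continuousM R S); first exact: cst_continuous.
rewrite /dot.
apply: (@continuous_big R 'I_3 +%R 0 xpredT (@add_continuous _) S
  (index_enum _) (fun i (y : S) => (\val y : 'rV[R]_3) ord0 i * u ord0 i)) => j _ {}x.
by apply: (@continuousM R S); [exact: coord3_continuous|exact: cst_continuous].
Qed.

(** Both the domain and the target plane are open, so continuity within them becomes ambient
    continuity. *)
Lemma chartP (X : topologicalType) (U : set X) (phi : X -> C) : chart U phi ->
  exists psi : C -> X, [/\ open U, forall x, U x -> {for x, continuous phi}, continuous psi,
    forall x, U x -> psi (phi x) = x & forall z, U (psi z) /\ phi (psi z) = z].
Proof.
move=> [oU [psi [cphi cpsi phiK psiK]]]; exists psi; split => //.
- by move=> x Ux; move: cphi; rewrite (continuous_open_subspace _ oU) => h; apply: h; exact/mem_set.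
- by move: cpsi; rewrite (continuous_open_subspace _ openT) => h x; apply: h; exact/mem_set.
- by move=> x Ux; have [] := phiK x Ux.
- by move=> z; exact: psiK.
Qed.

Lemma chart_shift (X : topologicalType) (U : set X) (phi : X -> C) (c : C) :
  chart U phi -> chart U (fun x => phi x - c).
Proof.
move=> /chartP[psi [oU cphi cpsi phiK psiK]]; split => //.
exists (fun z => psi (z + c)); split.
- rewrite (continuous_open_subspace _ oU) => x /set_mem /cphi cx.
  exact: (@continuousB R[i] C X phi (fun=> c) x cx (@cst_continuous _ _ c _)).
- apply: continuous_subspaceT => z.
  apply: (@continuous_comp C C X (fun z => z + c) psi z _ (cpsi _)).
  by apply: (@continuousD R[i] C C); [exact: cvg_id|exact: cst_continuous].
- by move=> x Ux; split => //; rewrite subrK phiK.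
- by move=> z _; have [Uz zK] := psiK (z + c); rewrite zK addrK.
Qed.

(** A reflection takes [p] to the pole [N], the only point of the sphere with third coordinate 1;
    stereographic projection from [N] follows. *)
Lemma sphere_punctured_chart (p : S) : exists phi : S -> C, chart [set~ p] phi.
Proof.
have p1 : 1 ^+ 2 = 1 :> R by rewrite expr1n.
have N1 : (0 : R) ^+ 2 + 0 ^+ 2 + 1 ^+ 2 = 1 by rewrite expr0n expr1n /= !add0r.
pose N : S :=
  exist (fun v => v \in [set v : 'rV[R]_3 | \sum_i v ord0 i ^+ 2 = 1]) _ (mkrowP N1).
have [h ch [hK hpN]] := sphere_reflection p N.
have dom x : x <> p -> stereo_dom 1 (h x).
  move=> xp; apply/eqP => x1; apply: xp; rewrite -(hK x) -(hK p); congr h; rewrite hpN.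
  have := coord3E (h x); rewrite x1 expr1n => /eqP; rewrite -subr_eq0 addrK.
  rewrite paddr_eq0 ?sqr_ge0// !sqrf_eq0 => /andP[/eqP e0 /eqP e1].
  by apply: coord3_inj; rewrite ?e0 ?e1 ?x1 /coord3 /= mxE inordK.
have [psi [oD cphi cpsi phiK psiK]] := chartP (stereo_chart p1).
have oX : open [set~ p].
  exact/closed_openC/accessible_closed_set1/hausdorff_accessible/sphere_hausdorff.
exists (stereo 1 \o h); split => //; exists (h \o psi); split.
- rewrite (continuous_open_subspace _ oX) => x /set_mem xp.
  exact: (@continuous_comp S S C h (stereo 1) x (ch x) (cphi _ (dom _ xp))).
- apply: continuous_subspaceT => z.
  exact: (@continuous_comp C S S psi h z (cpsi z) (ch _)).
- by move=> x xp; split => //=; rewrite phiK ?hK//; exact: dom.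
- move=> z _ /=; rewrite hK (psiK _).2; split => //= zp.
  have := (psiK z).1; rewrite /stereo_dom /=.
  have -> : psi z = N by rewrite -(hK (psi _)) zp hpN.
  by rewrite /coord3 /= mxE inordK// eqxx.
Qed.

End sphere_charts.
(** * Roots of branched coverings of the sphere *)

Section roots_of_branched_coverings.
Context {R : realType}.
Local Notation C := (R[i]^o).
Local Notation S := (sphere R).
Local Notation Re := (@complex.Re R).
Local Notation Im := (@complex.Im R).

(** The squared modulus as an element of [R]; the norm of [R[i]] takes its values in [R[i]]. *)
Definition sqnorm (z : C) : R := Re z ^+ 2 + Im z ^+ 2.

Lemma sqnorm_continuous : continuous sqnorm.
Proof.
move=> z; apply: (@continuousD R R C); apply: (@continuousM R C);
  by [exact: Re_continuous|exact: Im_continuous].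
Qed.

Lemma sqnorm_rect (e : R) (z : C) :
  0 < e -> sqnorm z <= (e / 2) ^+ 2 -> rect (0 - e) (0 + e) (0 - e) (0 + e) z.
Proof.
move=> e0; rewrite /sqnorm => h.
have L (x : R) : x ^+ 2 <= (e / 2) ^+ 2 -> - e < x < e.
  move=> xe; rewrite -ltr_norml; apply: (@le_lt_trans _ _ (e / 2)); last by lra.
  by rewrite -(ler_pXn2r (n := 2)) ?nnegrE ?divr_ge0 ?(ltW e0)// real_normK ?num_real.
have := sqr_ge0 (Re z); have := sqr_ge0 (Im z) => hi hr.
have /L/andP[? ?] : Re z ^+ 2 <= (e / 2) ^+ 2 by lra.
have /L/andP[? ?] : Im z ^+ 2 <= (e / 2) ^+ 2 by lra.
by split; rewrite ?sub0r ?add0r.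
Qed.

(** The map is the identity on the disc and the inversion in its boundary circle outside. It extends
    a function given near 0 to the whole plane without creating new zeros of the argument. *)
Lemma disc_retraction (rho : R) : 0 < rho -> exists ret : C -> C,
  [/\ continuous ret, forall z : C, z != 0 -> ret z != 0, forall z, sqnorm (ret z) <= rho &
      forall z, sqnorm z <= rho -> ret z = z].
Proof.
move=> rho0; pose M (z : C) : R := Num.max 1 (sqnorm z / rho).
have M1 z : 1 <= M z by rewrite le_max lexx.
have M0 z : M z != 0 by rewrite gt_eqF// (lt_le_trans ltr01).
have cM : continuous M.
  move=> z; apply: (@continuous_max R C (fun=> 1) (fun z => sqnorm z / rho)).
    exact: cst_continuous.
  by apply: (@continuousM R C); [exact: sqnorm_continuous|exact: cst_continuous].
have cV z : {for z, continuous (fun z => (M z)^-1)}.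
  by apply: (@continuousV R C) => //; exact: cM.
exists (fun z => Complex (Re z / M z) (Im z / M z)); split.
- move=> z; apply: (@Complex_cvg R C (fun z => Re z / M z) (fun z => Im z / M z) z).
    by apply: (@continuousM R C) (cV z); exact: Re_continuous.
  by apply: (@continuousM R C) (cV z); exact: Im_continuous.
- case=> a b; apply: contra_neq => /eqP; rewrite eq_complex /= !mulf_eq0 !invr_eq0.
  by rewrite (negbTE (M0 _)) !orbF => /andP[/eqP -> /eqP ->].
- move=> z; rewrite /sqnorm /= !exprMn -mulrDl -/(sqnorm z) exprVn.
  have Mp : 0 < M z ^+ 2 by rewrite exprn_gt0// (lt_le_trans ltr01).
  rewrite ler_pdivrMr//.
  have [h|h] := lerP (sqnorm z / rho) 1.
    apply: (@le_trans _ _ rho); first by rewrite -[leRHS]mul1r -ler_pdivrMr.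
    by rewrite ler_peMr ?(ltW rho0)// exprn_ege1.
  have -> : M z = sqnorm z / rho by rewrite /M max_r// ltW.
  have -> : sqnorm z = rho * (sqnorm z / rho) by rewrite mulrC divfK// gt_eqF.
  set s := sqnorm z / rho in h *; have -> : rho * s / rho = s by rewrite mulrAC divff ?mul1r// gt_eqF.
  by rewrite ler_pM2l// expr2 ler_peMl// ltW// (lt_trans ltr01).
- move=> z h; have -> : M z = 1 by rewrite /M max_l// ler_pdivrMr// mul1r.
  by rewrite !divr1; case: (z).
Qed.

Variable k : nat.
Hypothesis k0 : (0 < k)%N.

(** In charts [f] is [z ^+ m] with [m = l * k], that is, the [k]-th power of [z ^+ l]. So a root of
    [h (z ^+ k)], where [h] is [W] read in the chart of [Y], is evaluated at [phi x ^+ l]. *)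
Lemma kroot_at_branch (X Y : topologicalType) (f : X -> Y) (W : Y -> C) (D : set Y) (p : X) (m : nat) :
  accessible_space Y -> finite_set D ->
  (forall y, ~ D y -> {for y, continuous W} /\ W y != 0) ->
  local_degree R f p m -> (k %| m)%N -> D (f p) ->
  exists2 U : set X, nbhs p U & kroot k (W \o f) (U `\` f @^-1` D).
Proof.
move=> Y1 fD WD [m0 [U [V [phi [psi [cU cV [Up phi0] [Vp psi0] E]]]]]] km Dp.
have [phii [oU cphi _ _ _]] := chartP cU.
have [psii [oV _ cpsii psiK psiiK]] := chartP cV.
have psii0 : psii 0 = f p by rewrite -psi0 psiK.
have nB : nbhs (0 : C) (psii @^-1` (~` (D `\ f p))).
  apply: cpsii; rewrite psii0; apply: open_nbhs_nbhs; split; last by case=> _; apply.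
  apply: closed_openC; have /accessible_finite_set_closed := Y1; apply.
  by apply: sub_finite_set fD => y [].
have [e e0 eB] := nbhs_rect nB.
have rho0 : 0 < (e / 2) ^+ 2 by rewrite exprn_gt0// divr_gt0.
have [ret [cret ret0 retN retE]] := disc_retraction rho0.
(* The retraction onto a disc whose only possible point over [D] is 0 makes [h] continuous and
   nonzero on all of the punctured plane, as [kroot_power] requires. *)
pose h z := W (psii (ret z)).
have retD z : z != 0 -> ~ D (psii (ret z)).
  move=> z0 Dz; apply: (eB (ret z)); first exact: sqnorm_rect.
  split => // zp; have := ret0 _ z0; rewrite -(psiiK (ret z)).2 zp psi0 eqxx.
  by [].
have hP z : z != 0 -> {for z, continuous h} /\ h z != 0.
  move=> /retD/WD[cW W0]; split => //.
  apply: (@continuous_comp C C _ ret (W \o psii) z (cret z)).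
  exact: (@continuous_comp C Y C psii W (ret z) (cpsii _) cW).
have [r rP] := kroot_power k0 hP.
have /dvdnP[l ml] := km.
pose A := U `&` [set x | sqnorm (phi x ^+ m) < (e / 2) ^+ 2].
exists A.
  apply: filterI; first exact: open_nbhs_nbhs.
  have c1 := @continuous_comp X C C phi (fun z => z ^+ m) p (cphi _ Up) (@power_continuous R m _).
  have c2 := @continuous_comp X C R _ sqnorm p c1 (@sqnorm_continuous _).
  apply: (continuous_near (A := [set t | t < (e / 2) ^+ 2]) c2).
  apply: lt_nbhsl; rewrite /= phi0 expr0n gtn_eqF// /sqnorm /= expr0n /= addr0.
  exact: rho0.
exists (fun x => r (phi x ^+ l)) => x [[Ux xe] Dx].
have [Vx Ex] := E x Ux.
have x0 : phi x != 0.
  apply/eqP => px; apply: Dx; rewrite /preimage /= -(psiK _ Vx) Ex px expr0n gtn_eqF//.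
  by rewrite psii0.
have xl0 : phi x ^+ l != 0 by rewrite expf_neq0.
have [cr rk] := rP (phi x ^+ l) (elimN eqP xl0).
split.
  have c1 := @continuous_comp X C C phi (fun z => z ^+ l) x (cphi _ Ux) (@power_continuous R l _).
  exact: (@continuous_comp X C C (fun x => phi x ^+ l) r x c1 cr).
by rewrite rk /h /= -exprM -ml retE ?ltW// -Ex psiK.
Qed.

(** The point [q] lies over [D], so the root is only sought on the sphere minus [q], a plane in the
    chart [tau]. Local roots come from [kroot_at_branch] over [D] and from [kroot_local] elsewhere,
    and [kroot_plane] joins them. *)
Lemma kroot_sphere (f : S -> S) (W : S -> C) (D : set S) (q : S) :
  continuous f -> finite_set D -> finite_set (f @^-1` D) ->
  (forall y, ~ D y -> {for y, continuous W} /\ W y != 0) -> D (f q) ->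
  (forall p, D (f p) -> exists2 m, local_degree R f p m & (k %| m)%N) ->
  kroot k (W \o f) (~` (f @^-1` D)).
Proof.
move=> cf fD ffD WD Dq kD.
have S1 : accessible_space S by exact/hausdorff_accessible/sphere_hausdorff.
have [tau /chartP[sg [_ ctau csg tauK sgK]]] := sphere_punctured_chart q.
pose P := sg @^-1` (f @^-1` D).
have fP : finite_set P.
  by apply: finite_preimage => // z w _ _ zw; rewrite -(sgK z).2 -(sgK w).2 zw.
pose G := W \o f \o sg.
have G0 z : ~ P z -> G z != 0 by move=> /WD[].
have [r rP] : kroot k G (~` P).
  apply: (kroot_plane k0 fP G0) => z.
  have [U nU [r rU]] : exists2 U : set S, nbhs (sg z) U & kroot k (W \o f) (U `\` f @^-1` D).
    have [Dz|nDz] := pselect (D (f (sg z))).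
      by have [m dm km] := kD _ Dz; exact: kroot_at_branch dm km Dz.
    have [|//|U nU rU] := @kroot_local R k k0 S (W \o f) (sg z); last 1 first.
    - by exists U => //; apply: kroot_sub rU => ? [].
    - have : nbhs (sg z) (f @^-1` (~` D)).
        apply: cf; apply: open_nbhs_nbhs; split => //; apply: closed_openC.
        by have /accessible_finite_set_closed := S1; apply.
      move=> H; apply: filterS H => y /WD[cW _].
      exact: (@continuous_comp S S C f W y (cf y) cW).
    - by have [] := WD _ nDz.
  exists (sg @^-1` U); first exact: csg.
  exists (r \o sg) => w [Uw Pw]; have [cr rk] := rU (sg w) (conj Uw Pw).
  split => //; exact: (@continuous_comp C S C sg r w (csg w) cr).
exists (r \o tau) => p Dp.
have pq : p <> q by move=> pq; apply: Dp; rewrite pq.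
have Pp : ~ P (tau p) by rewrite /P /preimage /= tauK.
have [cr rk] := rP _ Pp; split; last by rewrite /= rk /G /= tauK.
exact: (@continuous_comp S C C tau r p (ctau _ pq) cr).
Qed.

End roots_of_branched_coverings.
(** * Level sets of the root *)

Section fibre_counting.
Context {R : realType}.
Local Notation C := (R[i]^o).

Lemma primitive_root_exists (n : nat) : (0 < n)%N ->
  exists z : R[i], n.-primitive_root z.
Proof.
move=> n0; pose p : {poly R[i]} := 'X^n - 1.
have [rs pE] := closed_field_poly_normal p.
rewrite (monicP _) ?monicXnsubC// scale1r in pE.
have rn1 : all n.-unity_root rs by apply/allP => z; rewrite -root_prod_XsubC -pE.
have sz : (n < (size rs).+1)%N by rewrite -(size_prod_XsubC rs id) -pE size_XnsubC.
have [|z] := hasP (cyclic.has_prim_root n0 rn1 _ sz); last by exists z.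
by rewrite -separable.separable_prod_XsubC -pE cyclotomic.separable_Xn_sub_1// pnatr_eq0 -lt0n.
Qed.

Lemma prim_root_expr_inj n (z : R[i]) : n.-primitive_root z ->
  injective (fun i : 'I_n => z ^+ i).
Proof.
move=> pz i j /eqP; rewrite (eq_prim_root_expr pz) => /eqP.
by rewrite !modn_small// => /val_inj.
Qed.

Lemma power_preimages (n : nat) (c : C) : (0 < n)%N -> c != 0 ->
  exists E : 'I_n -> C, injective E /\ forall i, E i ^+ n = c.
Proof.
move=> n0 c0; have [z pz] := primitive_root_exists n0.
have a_n : (n.-root (c : R[i])) ^+ n = c by exact: rootCK.
have a0 : n.-root (c : R[i]) != 0 := kroot_neq0 n0 a_n c0.
exists (fun i => n.-root (c : R[i]) * z ^+ i); split.
  by move=> i j /(mulfI a0)/(prim_root_expr_inj pz).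
by move=> i; rewrite exprMn a_n exprAC (prim_expr_order pz) expr1n mulr1.
Qed.

(** If [u] and [w] are close to [w0], then [u / w] is close to 1, where the only [k]-th root of
    unity is 1. *)
Lemma power_locally_injective (k : nat) (w0 : C) : (0 < k)%N -> w0 != 0 ->
  exists2 Q : set C, nbhs w0 Q & forall u w, Q u -> Q w -> u ^+ k = w ^+ k -> u = w.
Proof.
move=> k0 w00.
have cq : {for (w0, w0), continuous (fun p : C * C => p.1 / p.2 : C)}.
  have c1 : {for (w0, w0), continuous (@fst C C)} by exact: cvg_fst.
  have c2 : {for (w0, w0), continuous (@snd C C)} by exact: cvg_snd.
  exact: (@continuousM R[i] (C * C)%type _ _ _ c1 (@continuousV R[i] (C * C)%type snd (w0, w0) w00 c2)).
have n1 : nbhs (w0 / w0 : C) [set q : C | q ^+ k = 1 -> q = 1].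
  by rewrite divff//; exact: unity_root_isolated.
have [[A B] [/= nA nB] AB] := continuous_near cq n1.
have n0 : nbhs w0 [set~ (0 : C)].
  by apply: open_nbhs_nbhs; split; [exact/closed_openC/accessible_closed_set1/C_accessible|exact/eqP].
exists (A `&` B `&` [set~ 0]); first by do 2 apply: filterI => //.
move=> u w [[Au _] _] [[_ Bw] /eqP w0'] uw.
have /= := AB (u, w) (conj Au Bw); rewrite exprMn exprVn uw divff ?expf_neq0// => /(_ erefl) h.
by rewrite -[u](divfK w0') h mul1r.
Qed.

Lemma sqnormM (z w : C) : sqnorm (z * w) = sqnorm z * sqnorm w.
Proof. by case: z w => [a b] [c d]; rewrite /sqnorm /=; ring. Qed.

Lemma sqnormX (z : C) n : sqnorm (z ^+ n) = sqnorm z ^+ n.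
Proof.
elim: n => [|n IH]; last by rewrite !exprS sqnormM IH.
by rewrite /sqnorm /= expr1n expr0n addr0.
Qed.

Lemma sqnorm_ge0 (z : C) : 0 <= sqnorm z.
Proof. by rewrite addr_ge0 ?sqr_ge0. Qed.

Lemma hausdorff_separate (X : topologicalType) (n : nat) (e : 'I_n -> X) :
  hausdorff_space X -> injective e ->
  exists U : 'I_n -> set X, (forall i, nbhs (e i) (U i)) /\
    forall i j x, U i x -> U j x -> i = j.
Proof.
rewrite open_hausdorff => HX ei.
have /choice[AB ABP] : forall ij : 'I_n * 'I_n, exists AB : set X * set X,
    ij.1 != ij.2 -> [/\ nbhs (e ij.1) AB.1, nbhs (e ij.2) AB.2 & AB.1 `&` AB.2 = set0].
  move=> [i j] /=; have [->|ij] := eqVneq i j; first by exists (set0, set0).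
  have [|[A B] /= [Ai Bj] [oA oB /eqP AB]] := HX (e i) (e j).
    by apply: contra_neq ij => /ei.
  exists (A, B) => _; split => //; apply: open_nbhs_nbhs; split => //; exact/set_mem.
exists (fun i => [set x | forall j, i != j -> (AB (i, j)).1 x /\ (AB (j, i)).2 x]); split.
  move=> i; apply: filter_forall => j; have [->|ij] := eqVneq i j; first exact: filterE.
  have [h1 _ _] := ABP (i, j) ij; have [_ h2 _] := ABP (j, i) (negbT (etrans (eq_sym j i) (negbTE ij))).
  by apply: filterS2 h1 h2 => x.
move=> i j x Ui Uj; apply/eqP/negPn/negP => ij.
have [h1 _] := Ui j ij; have [_ h2] := Uj i (negbT (etrans (eq_sym j i) (negbTE ij))).
have [_ _ h] := ABP (i, j) ij; have : ((AB (i, j)).1 `&` (AB (i, j)).2) x by [].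
by rewrite h.
Qed.

Variables (X Y : topologicalType) (f : X -> Y) (k d : nat).
Variables (x0 x1 : Y) (W : Y -> C) (r : X -> C).
Hypotheses (k0 : (0 < k)%N) (HX : hausdorff_space X) (AY : accessible_space Y).
Hypotheses (cf : continuous f) (cW : chart [set~ x1] W) (W0 : W x0 = 0) (x01 : x0 <> x1).
Hypothesis f_deg : forall p, exists m, local_degree R f p m.

Let D : set Y := [set x0; x1].

Hypothesis rP : forall p, ~ D (f p) -> {for p, continuous r} /\ r p ^+ k = W (f p).

Definition level (w : C) : set X := [set p | ~ D (f p) /\ r p = w].

Lemma W_neq0 (y : Y) : ~ D y -> W y != 0.
Proof.
have [Wi [_ _ _ WK _]] := chartP cW.
move=> Dy; apply: contra_notN Dy => /eqP Wy; have [->|/eqP y1] := eqVneq y x1; first by right.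
by left; rewrite -(WK _ y1) Wy -W0 WK.
Qed.

(* As [r] is a local branch of [k.-root (W \o f)], the [m] preimages under [f]
   near [p] of a point near [f p] all lie in a single level of [r]. *)
Lemma level_near (p : X) (m : nat) (U : set X) : ~ D (f p) -> local_degree R f p m -> nbhs p U ->
  \forall w \near r p, w <> r p ->
    exists E : 'I_m -> X, injective E /\ forall i, U (E i) /\ level w (E i).
Proof.
move=> Dp [m0 [A [V [phi [psi [cA cV [Ap phi0] [Vp psi0] E]]]]]] nU.
have [Wi [_ cWp cWi WK WiK]] := chartP cW.
have [phii [_ cphi cphii phiK phiiK]] := chartP cA.
have [psii [oV cpsi _ psiK _]] := chartP cV.
have [cr rk] := rP Dp.
have r0 : r p != 0 by apply: (kroot_neq0 k0 rk); exact: W_neq0.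
have [Q nQ Qinj] := power_locally_injective k0 r0.
have Qr : Q (r p) := nbhs_singleton nQ.
have phii0 : phii 0 = p by rewrite -phi0 phiK.
have D_near : nbhs p (f @^-1` (~` D)).
  apply: cf; apply: open_nbhs_nbhs; split => //; apply: closed_openC.
  by have /accessible_finite_set_closed := AY; apply; exact: finite_set2.
have nB : nbhs (0 : C) (phii @^-1` (U `&` r @^-1` Q `&` f @^-1` (~` D))).
  by apply: cphii; rewrite phii0; apply: filterI => //; apply: filterI => //; exact: cr.
have [e e0 eB] := nbhs_rect nB.
pose rho := (e / 2) ^+ 2.
have rho0 : 0 < rho by rewrite exprn_gt0// divr_gt0.
have fp1 : f p <> x1 by move=> fp; apply: Dp; right.
(* The point of [Y] over which the whole level [w] of [r] lies. *)
pose g (w : C) : Y := Wi (w ^+ k).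
have gr : g (r p) = f p by rewrite /g rk WK.
have cg : {for r p, continuous g}.
  exact: (@continuous_comp C C Y (fun w => w ^+ k) Wi (r p) (@power_continuous R k _) (cWi _)).
(* The bound [rho ^+ m] forces the [m]-th roots of [psi (g w)] into the disc [sqnorm z <= rho]. *)
have nV : nbhs (r p) (g @^-1` (V `&` [set y | sqnorm (psi y) < rho ^+ m])).
  apply: cg; rewrite gr; apply: filterI; first exact: open_nbhs_nbhs.
  have cs := @continuous_comp Y C R psi sqnorm (f p) (cpsi _ Vp) (@sqnorm_continuous _ _).
  apply: (continuous_near (A := [set t | t < rho ^+ m]) cs); apply: lt_nbhsl.
  by rewrite /= psi0 /sqnorm /= expr0n addr0 exprn_gt0.
apply: filterS2 nQ nV => w Qw [Vw sw] wr.
have z0 : psi (g w) != 0.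
  apply: contra_notN wr => /eqP h; apply: (Qinj w (r p) Qw Qr).
  rewrite rk -(WiK (w ^+ k)).2 -/(g w); congr W.
  by rewrite -(psiK _ Vw) h -psi0 psiK.
have [z [zi zm]] := power_preimages m0 z0.
have zB i : (U `&` r @^-1` Q `&` f @^-1` (~` D)) (phii (z i)).
  apply: eB; apply: sqnorm_rect => //; rewrite -/rho -(ler_pXn2r m0) ?nnegrE ?sqnorm_ge0// ?ltW//.
  by rewrite -sqnormX zm.
exists (phii \o z); split=> [i j /= /(congr1 phi)|i].
  by rewrite !(phiiK _).2 => /zi.
have [[Ui Qi] Di] := zB i; split => //; split => //.
(* The value of [r] at this preimage and [w] both lie in [Q] and have the same [k]-th power, so they
   coincide. *)
apply: Qinj => //; rewrite (rP Di).2 -(WiK (w ^+ k)).2 -/(g w); congr W.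
have [Vi Ei] := E _ (phiiK (z i)).1.
by rewrite -(psiK _ Vi) Ei (phiiK _).2 zm psiK.
Qed.

(** The exceptional values of [W], off which fibres of [f] have [d] points. The hypothesis [f_card]
    quantifies over all right inverses of [W] avoiding [x1], as a chart provides its inverse only
    existentially. *)
Variable B : set C.
Hypothesis fB : finite_set B.
Hypothesis f_card : forall Wi : C -> Y, (forall c, Wi c <> x1 /\ W (Wi c) = c) ->
  forall c, ~ B c -> c != 0 /\ (f @^-1` [set Wi c] #= `I_d)%card.

(** [fset_set] is empty on infinite sets, so this is a cardinality only where the level is finite,
    in particular for good [w]. *)
Definition level_card (w : C) : nat := size (finmap.enum_fset (fset_set (level w))).

Let good (w : C) := ~ B (w ^+ k).

Lemma level_finite (w : C) : good w -> finite_set (level w).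
Proof.
have [Wi [_ _ _ WK WiK]] := chartP cW => gw.
have [_ fc] := f_card WiK gw.
apply: (@sub_finite_set _ _ (f @^-1` [set Wi (w ^+ k)])); last by exists d.
move=> p [Dp <-]; rewrite /= (rP Dp).2 WK// => fp; apply: Dp; by right.
Qed.

Lemma level_card_ge (w : C) (n : nat) (e : 'I_n -> X) : good w -> injective e ->
  (forall i, level w (e i)) -> (n <= level_card w)%N.
Proof.
move=> gw ei eL; rewrite -[n in (n <= _)%N]card_ord cardE -(size_map e).
apply: uniq_leq_size; first by rewrite map_inj_uniq ?enum_uniq.
by move=> _ /mapP[i _ ->]; rewrite in_fset_set ?mem_setE; [exact/mem_set|exact: level_finite].
Qed.

(** On the fibre of [f] over the point with [W]-value [w ^+ k], the [k]-th power of [r] is [w ^+ k],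
    so [r] takes the values [w * om ^+ l] and these partition the [d] points. *)
Lemma sum_level_card (w om : C) : k.-primitive_root (om : R[i]) -> good w ->
  (\sum_(l < k) level_card (w * om ^+ l)%R = d)%N.
Proof.
move=> pom gw; have [Wi [_ _ _ WK WiK]] := chartP cW.
have [w0 fc] := f_card WiK gw.
have wn0 : w != 0 by apply: contra_neq w0 => ->; rewrite expr0n gtn_eqF.
pose T := finmap.enum_fset (fset_set (f @^-1` [set Wi (w ^+ k)])).
have TP p : (p \in T) = (p \in f @^-1` [set Wi (w ^+ k)]).
  by rewrite in_fset_set//; exists d.
have fD p : f p = Wi (w ^+ k) -> ~ D (f p).
  move=> fp [|] fpx; last by apply: (WiK (w ^+ k)).1; rewrite -fp.
  by move: w0; rewrite -(WiK (w ^+ k)).2 -fp fpx W0 eqxx.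
have omk l : (om ^+ l) ^+ k = 1.
  by rewrite exprAC (prim_expr_order pom) expr1n.
(* The exponent labelling the level of [p], with default 0 off the fibre. *)
have /choice[lab labP] : forall p, exists l : 'I_k, f p = Wi (w ^+ k) -> r p = w * om ^+ l.
  move=> p; have [fp|nfp] := pselect (f p = Wi (w ^+ k)); last by exists (Ordinal k0).
  have rk : (r p / w) ^+ k = 1.
    by rewrite exprMn exprVn (rP (fD _ fp)).2 fp (WiK _).2 divff// expf_neq0.
  have [l lE] := prim_rootP pom rk; exists l => _.
  by rewrite -[r p](divfK wn0) [LHS]mulrC; congr (_ * _).
have <- : size T = d by exact: card_fset_set.
rewrite -sum1_size (partition_big lab xpredT)//=; apply: eq_bigr => l _.
rewrite -big_filter sum1_size; apply/perm_size/uniq_perm.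
- exact: finmap.fset_uniq.
- by apply: filter_uniq; exact: finmap.fset_uniq.
have gl : good (w * om ^+ l) by rewrite /good exprMn omk mulr1.
move=> p; rewrite mem_filter TP in_fset_set; last exact: level_finite.
apply/idP/andP => [/set_mem[Dp rp]|[/eqP pl /set_mem fp]].
  have fp : f p = Wi (w ^+ k).
    have := (rP Dp).2; rewrite rp exprMn omk mulr1 => ->.
    by rewrite WK// => fp; apply: Dp; right.
  split; last exact/mem_set.
  have := labP _ fp; rewrite rp => /(mulfI wn0) h.
  by rewrite (prim_root_expr_inj pom h).
apply/mem_set; split; first exact: fD.
by rewrite (labP p fp) pl.
Qed.

(** The points of the level [w0] have disjoint neighbourhoods, and by [level_near] each of these
    meets the level [w] once [w] is close to [w0]. *)
Lemma level_card_lsc (w0 : C) : good w0 ->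
  \forall w \near w0, good w -> (level_card w0 <= level_card w)%N.
Proof.
move=> gw; set T := finmap.enum_fset (fset_set (level w0)).
have TL p : p \in T -> level w0 p.
  by rewrite in_fset_set; [move/set_mem|exact: level_finite].
have uT : uniq T by exact: finmap.fset_uniq.
pose e (i : 'I_(size T)) := tnth (in_tuple T) i.
have eL i : level w0 (e i) by apply: TL; exact: mem_tnth.
have ei : injective e by exact/tuple_uniqP.
have [U [nU Uinj]] := hausdorff_separate HX ei.
have /filter_forall : forall i, \forall w \near w0, w <> w0 -> exists p, U i p /\ level w p.
  move=> i; have [Di ri] := eL i.
  have [m dm] := f_deg (e i); have := level_near Di dm (nU i); rewrite ri.
  move=> H; apply: filterS H => w h /h[E [_ EP]].
  by have m0 := dm.1; exists (E (Ordinal m0)).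
move=> H; apply: filterS H => w h gww.
have [->//|/eqP /h{}h] := eqVneq w w0.
have {h}/choice[q qP] : forall i, exists p, U i p /\ level w p by move=> i; apply: h.
apply: (level_card_ge (e := q) gww) => [i j qij|i]; last exact: (qP i).2.
by apply: (Uinj i j (q i)); [exact: (qP i).1|rewrite qij; exact: (qP j).1].
Qed.

Lemma good_cofinite : finite_set (~` [set w | good w]).
Proof.
have -> : ~` [set w | good w] = \bigcup_(c in B) [set w : C | w ^+ k = c].
  apply/seteqP; split => w /=.
    by move/contrapT => Bw; exists (w ^+ k).
  by move=> [c Bc wc] gw; apply: gw; rewrite wc.
by apply: bigcup_finite => // c _; exact: (finite_pow_eq k0).
Qed.

(* Each of the [k] cardinalities in [sum_level_card] is lower semicontinuous and
   their sum is constant, so each is locally constant on a cofinite, hence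
   connected, part of the plane. *)
Lemma level_card_const (w : C) : good w -> (level_card w * k = d)%N.
Proof.
move=> gw; have [om pom] := primitive_root_exists k0.
have omk l : (om ^+ l) ^+ k = 1.
  by rewrite exprAC (prim_expr_order pom) expr1n.
have gl u l : good u -> good (u * (om ^+ l : C)).
  by rewrite /good exprMn => gu; have -> : ((om ^+ l : C) ^+ k) = 1 by []; rewrite mulr1.
have lc : lconn [set u | good u].
  have -> : [set u | good u] = setT `\` ~` [set u | good u] by rewrite setTD setCK.
  by apply: C_punctures; [exact: openT|exact: lconn_C|exact: good_cofinite].
have const := @lconn_const _ _ _ level_card lc.
have {}const u v : good u -> good v -> level_card v = level_card u.
  apply: const => {}u gu.
  have /filter_forall : forall l : 'I_k, \forall v \near u, good (v * (om ^+ l : C)) ->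
      (level_card (u * (om ^+ l : C))%R <= level_card (v * (om ^+ l : C))%R)%N.
    move=> l.
    have cm : {for u, continuous (fun v : C => v * (om ^+ l : C))}.
      by apply: (@continuousM R[i] C); [exact: cvg_id|exact: cst_continuous].
    exact: (continuous_near cm (level_card_lsc (gl u l gu))).
  move=> H; apply: filterS H => {}v h gv.
  have := sum_level_card pom gu; rewrite -(sum_level_card pom gv).
  (* The term [l = 0] is the level itself. No term drops on passing from [u] to [v] and the sums
     agree, so this term is unchanged. *)
  rewrite (bigD1 (Ordinal k0))//= [in RHS](bigD1 (Ordinal k0))//= => E.
  have h0 := h (Ordinal k0) (gl _ _ gv).
  have hs : (\sum_(i < k | i != Ordinal k0) level_card (u * (om : C) ^+ i)%R <=
            \sum_(i < k | i != Ordinal k0) level_card (v * (om : C) ^+ i)%R)%N.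
    by apply: leq_sum => l _; apply: h; exact: gl.
  rewrite /= expr0 !mulr1 in h0 E.
  apply/eqP; rewrite eqn_leq h0 andbT.
  rewrite -(leq_add2r (\sum_(i < k | i != Ordinal k0) level_card (u * (om : C) ^+ i)%R)%N).
  by rewrite E leq_add2l.
rewrite -[RHS](sum_level_card pom gw) mulnC.
under eq_bigr => l _ do rewrite (const w _ gw (gl w l gw)).
by rewrite sum_nat_const card_ord.
Qed.

(** Only finitely many [w] are not good, so some good [w] different from [r p] is close to it; its
    level has at least [m] points by [level_near] and [d / k] points in all. *)
Lemma local_degree_le (p : X) (m : nat) : ~ D (f p) -> local_degree R f p m -> (m <= d %/ k)%N.
Proof.
move=> Dp dm; have nT : nbhs p setT by exact: filterT.
have := level_near Dp dm nT; move=> /nbhs_avoid/(_ good_cofinite)[w [h wr /contrapT gw]].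
have [E [Ei EL]] := h wr.
rewrite leq_divRL// -(level_card_const gw) leq_mul2r; apply/orP; right.
by apply: (level_card_ge gw Ei) => i; exact: (EL i).2.
Qed.

End fibre_counting.

(** * The bound for a realization of the branch datum *)

Theorem theorem1p4 (R : realType) (n d : nat) (m : 'I_n -> nat)
    (dd : forall i : 'I_n, 'I_(m i) -> nat) (k : nat)
    (hn : (2 <= n)%N)
    (hdatum : branch_datum R (sphere R) (sphere R) d dd)
    (hk : (1 < k < d)%N)
    (hkd : (k %| d)%N)
    (hkdd : forall i : 'I_n, (i < 2)%N -> forall j : 'I_(m i), (k %| dd i j)%N)
    (hreal : realizable R (sphere R) (sphere R) d dd) :
  forall i : 'I_n, (2 <= i)%N -> forall j : 'I_(m i), (dd i j <= d %/ k)%N.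
Proof.
have [_ _ d2 ddP] := hdatum; have /andP[k1 _] := hk; have k0 : (0 < k)%N := ltnW k1.
case: hreal => f [x [[cf f_loc] f_deg x_inj f_br fib]] i i2 j.
pose i0 : 'I_n := Ordinal (ltnW hn); pose i1 : 'I_n := Ordinal hn.
have x01 : x i0 <> x i1 by move=> /x_inj.
have [phi /(@chart_shift _ _ _ _ (phi (x i0))) cW] := sphere_punctured_chart (x i1).
set W := (fun _ => _) in cW; have W0 : W (x i0) = 0 by rewrite /W subrr.
pose D := [set x i0; x i1].
have WD y : ~ D y -> {for y, continuous W} /\ W y != 0.
  move=> Dy; split; last exact: (W_neq0 cW W0 x01 Dy).
  have [Wi [_ cWx _ _ _]] := chartP cW; apply: cWx => yx; apply: Dy.
  by rewrite yx; right.
have fib_finite l : finite_set (f @^-1` [set x l]).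
  by have [e [_ <- _]] := fib l; exact: finite_image.
(* The fibre is nonempty because an empty partition would sum to 0, while [d] is at least 2. The
   point [q] is the one removed in [kroot_sphere]. *)
have [q fq] : exists q, f q = x i0.
  have [e [_ re _]] := fib i0; have [_ sd] := ddP i0.
  have [m0|m0] := posnP (m i0).
    by exfalso; move: d2; rewrite -sd big1// => -[l lm]; exfalso; move: lm; rewrite m0.
  have : range e (e (Ordinal m0)) by exists (Ordinal m0).
  by rewrite re => fe; exists (e (Ordinal m0)).
have kD p : D (f p) -> exists2 l, local_degree R f p l & (k %| l)%N.
  have H (l : 'I_n) : (l < 2)%N -> f p = x l -> exists2 l, local_degree R f p l & (k %| l)%N.
    move=> l2 fp; have [e [_ re ed]] := fib l.
    have : (f @^-1` [set x l]) p by [].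
    by rewrite -re => -[a _ <-]; exists (dd l a); [exact: ed|exact: hkdd].
  by case; [exact: (H i0)|exact: (H i1)].
have fD : finite_set (f @^-1` D) by rewrite preimage_setU finite_setU; split; exact: fib_finite.
have [r rP] := kroot_sphere k0 cf (finite_set2 _ _) fD WD (or_introl fq : D (f q)) kD.
(* The exceptional values are the images of the marked points: these include all branching points,
   and [x i0] contributes the value 0. *)
have fB : finite_set (W @` range x) by do 2 apply: finite_image.
have f_card (Wi : R[i]^o -> sphere R) : (forall c, Wi c <> x i1 /\ W (Wi c) = c) ->
    forall c, ~ (W @` range x) c -> c != 0 /\ (f @^-1` [set Wi c] #= `I_d)%card.
  move=> WiK c Bc; split.
    by apply: contra_notN Bc => /eqP ->; exists (x i0) => //; exists i0.
  apply: f_deg => /f_br[l _ xl]; apply: Bc; exists (x l); first by exists l.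
  by rewrite xl; have [] := WiK c.
have [e [_ re ed]] := fib i.
have fe : f (e j) = x i by have : range e (e j) by [exists j]; rewrite re.
apply: (local_degree_le k0 sphere_hausdorff (hausdorff_accessible sphere_hausdorff)
  cf cW W0 x01 _ rP fB f_card _ (ed j)).
  by move=> p; have [l lp] := f_loc p; exists l.
by rewrite fe => -[] /x_inj ii; move: i2; rewrite ii.
Qed.
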